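(* Let $k$ be an algebraically closed field of characteristic zero, $G$ a finite group, $R_G=B^{(2)}_k(G,G)$, and let $\rho_G:R_G\to\operatorname{End}_{\mathbb Z}(\Omega^{(2)}_k(G))$, $\rho_G(x)(y)=x\circ_Gy$, be the canonical representation on $\Omega^{(2)}_k(G)=B^{(2)}_k(G,1)$. Then $\rho_G$ is faithful if and only if $G=1$. Suppose $G\ne1$, and let $C_G=(c_{b,c})_{b,c\in\Omega_G}$ be the composition matrix. If $C_G$ is singular, then $\ker(\rho_G)\cap J_G\ne0$. If $C_G$ is nonsingular, then $X\mapsto XC_G$ gives an isomorphism $$\mathbb Q\otimes_{\mathbb Z}J_G\xrightarrow{\ \sim\ }\operatorname{End}_{\mathbb Q}(\mathbb Q\Omega_G).$$ In the latter case, let $d$ be a positive integer such that $dC_G^{-1}$ is integral, and let $X_d\in J_G$ correspond to $dC_G^{-1}$. Then $d\,\mathbf 1_G-X_d$ is a nonzero element of $\ker(\rho_G)$, where $\mathbf 1_G=[\Delta(G),1]$ is the unit of $R_G$.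
   Context: For finite groups $G,H$, $B^{(2)}_k(G,H)$ is the free abelian group with distinguished basis $[L,\mu]$ indexed by $(G\times H)$-conjugacy classes of pairs $(L,[\mu])$, $L\le G\times H$, $[\mu]\in H^2(L,k^\times)$ (trivial action). $\Omega_G$ is the distinguished basis of $B^{(2)}_k(G,1)$, i.e. the set of $G$-conjugacy classes $[H,\alpha]$, $H\le G$, $[\alpha]\in H^2(H,k^\times)$; $B^{(2)}_k(1,1)=\mathbb Z$. For $S\le P\times Q$, $p_1(S),p_2(S)$ are the images in $P,Q$; $k_1(S)=\{a:(a,1)\in S\}$, $k_2(S)=\{b:(1,b)\in S\}$. Clifford composition $\circ_H:B^{(2)}_k(G,H)\times B^{(2)}_k(H,K)\to B^{(2)}_k(G,K)$ is bilinear and given on basis elements (normalized cocycles) by $$[L,\mu]\circ_H[M,\nu]=\sum_{g\in p_2(L)\backslash H/p_1(M)}\ \sum_{[\pi]\in N_g\backslash\mathrm{Irr}(A_g)}[N_{g,\pi},\lambda_{g,\pi}],$$ where $M^g=(g,1)M(g,1)^{-1}$, $\nu^g$ is $\nu$ transported along this conjugation, $F_g=\{((a,b),(b,c)):(a,b)\in L,(b,c)\in M^g\}$, $q_g((a,b),(b,c))=(a,c)$, $N_g=q_g(F_g)\le G\times K$, $K_g=k_2(L)\cap k_1(M^g)\cong\ker q_g$, $\eta_g=\mathrm{pr}_L^*\mu\,\mathrm{pr}_M^*\nu^g\in Z^2(F_g,k^\times)$, $\alpha_g=\eta_g|_{K_g}$. The twisted group algebra $\widetilde A_g=k_{\eta_g}[F_g]$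 ($u_fu_{f'}=\eta_g(f,f')u_{ff'}$) is strongly $N_g$-graded via $q_g$ with degree-one part $A_g=k_{\alpha_g}[K_g]$; $N_g$ acts on the set $\mathrm{Irr}(A_g)$ of isomorphism classes of simple modules by $n\cdot[\pi]=[(\widetilde A_g)_n\otimes_{A_g}\pi]$; $N_{g,\pi}$ is the stabilizer of $[\pi]$; for chosen isomorphisms $c_n:(\widetilde A_g)_n\otimes_{A_g}\pi\to\pi$ ($n\in N_{g,\pi}$) and multiplication maps $\vartheta_{n,m}$, the cocycle $\lambda_{g,\pi}$ is defined by $c_n(\mathrm{id}\otimes c_m)=\lambda_{g,\pi}(n,m)^{-1}c_{nm}(\vartheta_{n,m}\otimes\mathrm{id})$. Composition is associative with identities $[\Delta(G),1]$. $R_G=B^{(2)}_k(G,G)$ with product $\circ_G$. Duality: $[L,\mu]^\vee=[L^t,(\mu^t)^{-1}]$, where $L^t=\{(h,g):(g,h)\in L\}$ and $\mu^t$ is $\mu$ transported along the swap. For $a,b\in\Omega_G$, $E_{a,b}=a\circ_1b^\vee\in R_G$ (distinct basis elements), $J_G=\mathbb Z\text{-span}\{E_{a,b}\}$, a two-sided ideal, and $c_{b,c}\in\mathbb Z_{>0}$ is defined by $b^\vee\circ_Gc=c_{b,c}\in B^{(2)}_k(1,1)=\mathbb Z$; the matrix $C_G=(c_{b,c})$ is symmetric. After ordering $\Omega_G$, elements of $J_G$ (and of $\mathbb Q\otimes J_G$) are identified with square matrices by letting $E_{a,b}$ be the $(a,b)$ matrix unit; endomorphisms of $\mathbb Q\Omega_G$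 are likewise written as matrices. *)

(* Defs.v *)
From HB Require Import structures.
From mathcomp Require Import all_boot all_order all_algebra all_fingroup.
From mathcomp Require Import boolp classical_sets fsbigop.
From mathcomp Require Import ring.

Set Implicit Arguments.
Unset Strict Implicit.
Unset Printing Implicit Defensive.

Import GRing.Theory.

Local Open Scope ring_scope.

Fact unit_mulA : associative (fun _ _ : unit => tt). Proof. by []. Qed.
Fact unit_mul1 : left_id tt (fun _ _ : unit => tt). Proof. by case. Qed.
Fact unit_mulV : left_inverse tt (fun _ : unit => tt) (fun _ _ : unit => tt).
Proof. by []. Qed.
HB.instance Definition _ :=
  Finite_isGroup.Build unit unit_mulA unit_mul1 unit_mulV.

(* H^2(L, k^x) is computed from normalized cochains.  A 2-cochain on L is a   *)
(* function on T * T of which only the values on L * L matter.                *)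
Section TwistedPairs.

Variables (k : fieldType) (T : finGroupType).
Implicit Types (L : {set T}) (mu nu : T -> T -> k).

Definition is_cocycle L mu : Prop :=
  [/\ {in L &, forall x y, mu x y != 0},
      {in L, forall x, mu 1%g x = 1 /\ mu x 1%g = 1}
    & {in L & &, forall x y z,
        mu x y * mu (x * y)%g z = mu y z * mu x (y * z)%g}].

Definition cohomologous L mu nu : Prop :=
  exists2 f : T -> k, {in L, forall x, f x != 0}
    & {in L &, forall x y, nu x y = mu x y * (f x * f y / f (x * y)%g)}.

Definition twisted_pair : Type :=
  {p : {group T} * {ffun T * T -> k}
     | `[< is_cocycle p.1 (fun x y => p.2 (x, y)) >]}.

Definition tgroup (p : twisted_pair) : {group T} := (val p).1.
Definition tcocycle (p : twisted_pair) : T -> T -> k :=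
  fun x y => (val p).2 (x, y).

Lemma tcocycleP (p : twisted_pair) : is_cocycle (tgroup p) (tcocycle p).
Proof. exact/asboolP/(valP p). Qed.

Fact mk_twisted_pair_subproof (L : {group T}) mu : is_cocycle L mu ->
  `[< is_cocycle L (fun x y => [ffun z : T * T => mu z.1 z.2] (x, y)) >].
Proof.
case=> h1 h2 h3; apply/asboolP; split.
- by move=> x y xL yL /=; rewrite ffunE; exact: h1.
- by move=> x xL; rewrite !ffunE; exact: h2.
- by move=> x y z xL yL zL; rewrite !ffunE; exact: h3.
Qed.

Definition mk_twisted_pair (L : {group T}) mu (hmu : is_cocycle L mu) :
    twisted_pair :=
  Sub (L, [ffun z : T * T => mu z.1 z.2]) (mk_twisted_pair_subproof hmu).

(* (L, [mu]) and (L', [mu']) are T-conjugate. *)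
Definition twisted_conj (p q : twisted_pair) : Prop :=
  exists2 t : T, tgroup q = (tgroup p :^ t)%g :> {set T}
    & cohomologous (tgroup q)
        (fun x y => tcocycle p (x ^ t^-1)%g (y ^ t^-1)%g) (tcocycle q).

Lemma twisted_conj_refl p : twisted_conj p p.
Proof.
exists 1%g; first by rewrite conjsg1.
exists (fun=> 1) => [x _|x y _ _]; first by rewrite oner_eq0.
by rewrite invg1 !conjg1 !mulr1 invr1 !mulr1.
Qed.

Lemma twisted_conj_trans q p r :
  twisted_conj p q -> twisted_conj q r -> twisted_conj p r.
Proof.
move=> [t Lq [f f0 fE]] [u Lr [g g0 gE]].
have memV x : x \in tgroup r -> (x ^ u^-1)%g \in tgroup q.
  by rewrite Lr mem_conjg.
exists (t * u)%g; first by rewrite Lr Lq conjsgM.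
exists (fun x => f (x ^ u^-1)%g * g x) => [x xr|x y xr yr].
  by rewrite mulf_neq0 ?g0// f0// memV.
rewrite gE// fE ?memV// invMg !conjgM !conjMg.
have [xq yq] := (memV x xr, memV y yr).
have h1 := f0 _ (groupM xq yq); have h2 := g0 _ (groupM xr yr).
by field; rewrite h1 h2.
Qed.

Lemma twisted_conj_sym p q : twisted_conj p q -> twisted_conj q p.
Proof.
move=> [t Lq [f f0 fE]].
have memV x : x \in tgroup p -> (x ^ t)%g \in tgroup q.
  by rewrite Lq memJ_conjg.
exists t^-1%g; first by rewrite Lq /= conjsgK.
exists (fun x => (f (x ^ t)%g)^-1) => [x xp|x y xp yp].
  by rewrite invr_neq0 ?f0 ?memV.
rewrite invgK fE ?memV// !conjgK conjMg.
have [h1 h2] := (f0 _ (memV _ xp), f0 _ (memV _ yp)).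
have h3 := f0 _ (groupM (memV _ xp) (memV _ yp)).
by field; rewrite h1 h2 h3 oner_eq0.
Qed.

Definition twisted_eq (p q : twisted_pair) : bool := `[< twisted_conj p q >].

Fact twisted_eq_refl : reflexive twisted_eq.
Proof. by move=> p; apply/asboolP/twisted_conj_refl. Qed.
Fact twisted_eq_sym : symmetric twisted_eq.
Proof. by move=> p q; apply/asboolP/asboolP; exact: twisted_conj_sym. Qed.
Fact twisted_eq_trans : transitive twisted_eq.
Proof.
by move=> q p r /asboolP pq /asboolP qr; apply/asboolP/(twisted_conj_trans pq).
Qed.

Canonical twisted_eq_equiv :=
  EquivRel twisted_eq twisted_eq_refl twisted_eq_sym twisted_eq_trans.

Definition twisted_class : Type := {eq_quot twisted_eq}%qT.
HB.instance Definition _ := Choice.on twisted_class.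
HB.instance Definition _ := EqQuotient.on twisted_class.

Definition class_of (p : twisted_pair) : twisted_class :=
  (\pi_twisted_class p)%qT.
Definition class_repr (c : twisted_class) : twisted_pair :=
  generic_quotient.repr c.

Lemma class_reprK : cancel class_repr class_of.
Proof. exact: reprK. Qed.

Lemma class_ofP p q : class_of p = class_of q <-> twisted_conj p q.
Proof.
split=> [/eqmodP/asboolP//|pq].
by apply/eqmodP; apply/asboolP.
Qed.

End TwistedPairs.

Section Finiteness.

Variables (k : closedFieldType) (T : finGroupType).

Lemma cohomologous_cocycle (L : {group T}) (mu nu : T -> T -> k) (f : T -> k) :
    is_cocycle L mu -> {in L, forall x, f x != 0} -> f 1%g = 1 ->
    {in L &, forall x y, nu x y = mu x y * (f x * f y / f (x * y)%g)} ->
  is_cocycle L nu.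
Proof.
move=> [mu0 mu1 muM] f0 f1 nuE; split.
- move=> x y xL yL; rewrite nuE// !mulf_neq0 ?invr_neq0 ?mu0 ?f0//.
  exact: groupM.
- move=> x xL; have [m1 m2] := mu1 _ xL; have fx := f0 _ xL.
  by rewrite !nuE// m1 m2 mulg1 mul1g f1 !mul1r mulr1 divff.
- move=> x y z xL yL zL.
  have xyL := groupM xL yL; have yzL := groupM yL zL.
  rewrite !nuE//; have h1 := f0 _ xyL; have h2 := f0 _ yzL.
  have h3 := f0 _ (groupM xyL zL); rewrite mulgA.
  have E := muM _ _ _ xL yL zL.
  transitivity (mu x y * mu (x * y)%g z * (f x * f y * f z / f (x * y * z)%g)).
    by field; rewrite h1 h3.
  by rewrite E; field; rewrite h2 h3.
Qed.

Lemma exists_nth_root n (a : k) : (0 < n)%N -> exists b : k, b ^+ n = a.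
Proof.
move=> n0; have : size ('X^n - a%:P : {poly k}) != 1 by rewrite size_XnsubC// eqSS -lt0n.
move=> /closed_rootP[b]; rewrite rootE !hornerE subr_eq0 => /eqP bE.
by exists b.
Qed.

(* Each class is represented by a cocycle with values in the #|T|-th roots of *)
(* unity, which is why there are finitely many classes.                       *)
Lemma twisted_pair_roots (p : twisted_pair k T) :
  exists2 nu : T -> T -> k, is_cocycle (tgroup p) nu
    /\ cohomologous (tgroup p) (tcocycle p) nu
    & {in tgroup p &, forall x y, nu x y ^+ #|T| = 1}.
Proof.
have [] := tcocycleP p; set L := tgroup p; set mu := tcocycle p.
move=> mu0 mu1 muM; pose n := #|L|; pose f x := \prod_(y in L) mu x y.
have n0 : (0 < n)%N := cardG_gt0 L.
have f1 : f 1%g = 1 by rewrite /f big1// => y /mu1[].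
have f0 : {in L, forall x, f x != 0}.
  by move=> x xL; rewrite prodf_seq_neq0; apply/allP => y _; apply/implyP/mu0.
have fE : {in L &, forall x y, mu x y ^+ n * f (x * y)%g = f x * f y}.
  move=> x y xL yL; rewrite -prodr_const -big_split/=.
  rewrite (eq_bigr (fun z => mu y z * mu x (y * z)%g)); last first.
    by move=> z zL; rewrite muM.
  rewrite big_split mulrC; congr (_ * _).
  rewrite [RHS](reindex_inj (mulgI y)); apply: eq_bigl => z.
  by rewrite groupMl.
have [g gE] := choice (fun x => exists_nth_root (f x) n0).
pose h x := if x == 1%g then 1 else (g x)^-1.
have hE x : x \in L -> h x ^+ n = (f x)^-1.
  move=> xL; rewrite /h; case: eqP => [->|_]; first by rewrite f1 expr1n invr1.
  by rewrite exprVn gE.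
have h1 : h 1%g = 1 by rewrite /h eqxx.
have h0 : {in L, forall x, h x != 0}.
  move=> x xL; have := invr_neq0 (f0 _ xL); rewrite -hE//.
  by apply: contraNneq => ->; rewrite expr0n gtn_eqF.
exists (fun x y => mu x y * (h x * h y / h (x * y)%g)).
  split; last by exists h.
  exact: (cohomologous_cocycle (tcocycleP p) h0 h1).
move=> x y xL yL; have /dvdnP[m ->] : (n %| #|T|)%N.
  by rewrite -cardsT cardSg// finset.subsetT.
rewrite mulnC exprM [X in X ^+ m](_ : _ = 1) ?expr1n//.
have xyL := groupM xL yL.
have [fx fy] := (f0 _ xL, f0 _ yL); have fxy := f0 _ xyL.
rewrite !exprMn exprVn !hE// invrK.
transitivity (mu x y ^+ n * f (x * y)%g / (f x * f y)).
  by field; rewrite fx fy.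
by rewrite fE// divff// mulf_neq0.
Qed.

Lemma twisted_pair_finite : exists s : seq (twisted_pair k T),
  forall p, exists2 q, q \in s & twisted_conj p q.
Proof.
have [r rE] := closed_field_poly_normal ('X^#|T| - 1 : {poly k}).
have T0 : (0 < #|T|)%N by rewrite -cardsT cardG_gt0.
have rP (z : k) : z ^+ #|T| = 1 -> z \in 0 :: r.
  move=> zE; have : root ('X^#|T| - 1 : {poly k}) z.
    by rewrite rootE !hornerE zE subrr.
  rewrite rE rootZ ?lead_coef_eq0 -?size_poly_eq0 ?size_XnsubC//.
  by rewrite root_prod_XsubC inE orbC => ->.
pose R := seq_sub (0 :: r).
pose F (h : {group T} * {ffun T * T -> R}) : {group T} * {ffun T * T -> k} :=
  (h.1, [ffun z => ssval (h.2 z)]).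
exists (pmap insub (map F (enum {: {group T} * {ffun T * T -> R}}))) => p.
have [nu [nuc [f f0 fE]] nuE] := twisted_pair_roots p.
pose L := tgroup p; pose nu' x y := if (x \in L) && (y \in L) then nu x y else 0.
have nu'E : {in L &, forall x y, nu' x y = nu x y}.
  by move=> x y xL yL; rewrite /nu' xL yL.
have nu'c : is_cocycle L nu'.
  case: nuc => n0 n1 nM; split.
  - by move=> x y xL yL; rewrite nu'E// n0.
  - by move=> x xL; rewrite !nu'E//; apply: n1.
  - by move=> x y z xL yL zL; rewrite !nu'E ?groupM//; apply: nM.
exists (mk_twisted_pair nu'c); last first.
  exists 1%g; first by rewrite conjsg1.
  exists f => // x y xL yL; rewrite invg1 !conjg1 /tcocycle ffunE/=.
  by rewrite -[RHS]fE//; apply: nu'E.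
rewrite mem_pmap_sub; apply/mapP.
have nu'r x y : nu' x y \in 0 :: r.
  rewrite /nu'; case: ifP => [/andP[xL yL]|_]; last by rewrite mem_head.
  by apply/rP/nuE.
exists (L, [ffun z : T * T => SeqSub (nu'r z.1 z.2)]); first by rewrite mem_enum.
by congr (_, _); apply/ffunP => z; rewrite !ffunE.
Qed.

Let class_seq : seq (twisted_class k T) :=
  map (@class_of k T) (projT1 (cid twisted_pair_finite)).

Fact mem_class_seq c : c \in class_seq.
Proof.
rewrite /class_seq; case: cid => s sP /=.
have [q qs pq] := sP (class_repr c).
by apply/mapP; exists q => //; rewrite -[LHS]class_reprK; exact/class_ofP.
Qed.

Let class_sub (c : twisted_class k T) : seq_sub class_seq :=
  SeqSub (mem_class_seq c).
Fact class_subK : cancel class_sub (@ssval _ _). Proof. by []. Qed.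

HB.instance Definition _ :=
  Countable.copy (twisted_class k T) (can_type class_subK).
HB.instance Definition _ : isFinite (twisted_class k T) :=
  CanIsFinite class_subK.

End Finiteness.

Section TwistedGroupAlgebra.

Variables (k : fieldType) (T : finGroupType).

(* The twisted group algebra k_eta[F] is the space tg_span F of functions on  *)
(* T supported in F, with the product tg_mul eta, for which                   *)
(* tg_basis x * tg_basis y = eta x y *: tg_basis (x * y) on F.                *)
Definition tg_basis (x : T) : {ffun T -> k^o} := [ffun z => (z == x)%:R].

Definition tg_mul (eta : T -> T -> k) (a b : {ffun T -> k^o}) :
    {ffun T -> k^o} :=
  \sum_x \sum_y (a x * b y * eta x y : k) *: tg_basis (x * y)%g.

Definition tg_span (F : {set T}) : {vspace {ffun T -> k^o}} :=
  <<[seq tg_basis x | x <- enum F]>>%VS.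

(* A linear action of the functions on T on k^d.  For a module over           *)
(* k_alpha[K] only the action of tg_span K matters.                           *)
Definition tg_rep : Type := {d : nat & 'Hom({ffun T -> k^o}, 'M[k]_d)}.
HB.instance Definition _ := Choice.on tg_rep.

Definition rdim (V : tg_rep) : nat := tag V.
Definition ract (V : tg_rep) : {ffun T -> k^o} -> 'M[k]_(rdim V) := tagged V.

Variables (K : {set T}) (alpha : T -> T -> k).

Definition is_module (V : tg_rep) : Prop :=
  ract V (tg_basis 1%g) = 1%:M /\
  {in tg_span K &, forall a b,
    ract V (tg_mul alpha a b) = ract V a *m ract V b}.

Definition is_simple (V : tg_rep) : Prop :=
  [/\ is_module V, (0 < rdim V)%N
    & forall U : {vspace 'cV[k]_(rdim V)},
        {in tg_span K & U, forall a v, ract V a *m v \in U} ->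
        U = 0%VS \/ U = fullv].

Definition module_iso (V W : tg_rep) : Prop :=
  exists (P : 'M[k]_(rdim W, rdim V)) (Q : 'M[k]_(rdim V, rdim W)),
    [/\ Q *m P = 1%:M, P *m Q = 1%:M
      & {in tg_span K, forall a, P *m ract V a = ract W a *m P}].

Definition iso_class (V : tg_rep) : set tg_rep :=
  [set W | is_simple W /\ module_iso V W]%classic.

(* Simple modules over a finite-dimensional algebra are finite-dimensional,   *)
(* so every isomorphism class of simple modules appears on some k^d.          *)
Definition Irr : set (set tg_rep) :=
  [set X | exists2 V, is_simple V & X = iso_class V]%classic.

End TwistedGroupAlgebra.

(* The algebra At = k_eta[F] graded by S via q, with At_1 identified with     *)
(* k_alpha[K] along the isomorphism iota from K to the kernel of q on F.      *)
Section GradedClifford.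

Variables (k : fieldType) (T S H : finGroupType).
Variables (F : {set T}) (eta : T -> T -> k) (q : T -> S).
Variables (K : {set H}) (iota : H -> T).

Let N : {set S} := [set q f | f in F]%SET.
Let alpha (b b' : H) : k := eta (iota b) (iota b').

Definition tg_deg (n : S) : {vspace {ffun T -> k^o}} :=
  tg_span k [set f in F | q f == n]%SET.

Definition tg_emb (a : {ffun H -> k^o}) : {ffun T -> k^o} :=
  \sum_(b in K) (a b : k) *: tg_basis k (iota b).

(* At (x)_k V is the space of functions t : T -> V, where t stands for the    *)
(* sum of the u_f (x) t f.                                                    *)
Definition pure_tensor (V : tg_rep k H) (x : {ffun T -> k^o})
    (v : 'cV[k]_(rdim V)) : {ffun T -> 'cV[k]_(rdim V)} :=
  [ffun f => (x f : k) *: v].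

Definition in_tensor (V : tg_rep k H) (n : S)
    (t : {ffun T -> 'cV[k]_(rdim V)}) : Prop :=
  forall f, t f != 0 -> f \in F /\ q f = n.

(* The kernel of At_n (x)_k V -> At_n (x)_A V : the smallest subspace         *)
(* containing all the xa (x) v - x (x) av.                                    *)
Definition balancing (V : tg_rep k H) (n : S)
    (t : {ffun T -> 'cV[k]_(rdim V)}) : Prop :=
  forall U : {vspace {ffun T -> 'cV[k]_(rdim V)}},
    (forall x a (v : 'cV[k]_(rdim V)),
       x \in tg_deg n -> a \in tg_span k K ->
       pure_tensor (tg_mul eta x (tg_emb a)) v
         - pure_tensor x (ract V a *m v) \in U) ->
    t \in U.

(* c induces an isomorphism of A-modules At_n (x)_A V -> W. *)
Definition tensor_iso (V W : tg_rep k H) (n : S)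
    (c : 'Hom({ffun T -> 'cV[k]_(rdim V)}, 'cV[k]_(rdim W))) : Prop :=
  [/\ forall a x v, a \in tg_span k K -> x \in tg_deg n ->
        c (pure_tensor (tg_mul eta (tg_emb a) x) v)
          = ract W a *m c (pure_tensor x v),
      forall w, exists2 t, in_tensor n t & c t = w
    & forall t, in_tensor n t -> (c t = 0 <-> balancing n t)].

Definition irr_act (n : S) (X : set (tg_rep k H)) : set (tg_rep k H) :=
  [set W | is_simple K alpha W /\
           exists2 V, X V & exists c, tensor_iso (V := V) (W := W) n c]%classic.

Definition irr_orbit (X : set (tg_rep k H)) : set (set (tg_rep k H)) :=
  [set Y | exists2 n, n \in N & Y = irr_act n X]%classic.

Definition irr_orbits : set (set (set (tg_rep k H))) :=
  [set O | exists2 X, Irr K alpha X & O = irr_orbit X]%classic.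

Definition irr_stab (X : set (tg_rep k H)) : {set S} :=
  [set n in N | `[< irr_act n X = X >]]%SET.

(* p = (N_pi, lambda_pi) for the cocycle lambda_pi attached to some pi in X   *)
(* and some choice of isomorphisms c_n : At_n (x)_A pi -> pi.                 *)
Definition clifford_pair (X : set (tg_rep k H)) (p : twisted_pair k S) : Prop :=
  tgroup p = irr_stab X :> {set S} /\
  exists2 V, X V &
  exists2 c : S -> 'Hom({ffun T -> 'cV[k]_(rdim V)}, 'cV[k]_(rdim V)),
    {in irr_stab X, forall n, tensor_iso (V := V) (W := V) n (c n)}
  & {in irr_stab X &, forall n m x y (v : 'cV[k]_(rdim V)),
      x \in tg_deg n -> y \in tg_deg m ->
      c n (pure_tensor x (c m (pure_tensor y v)))
        = (tcocycle p n m)^-1 *: c (n * m)%g (pure_tensor (tg_mul eta x y) v)}.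

End GradedClifford.

Section Composition.

Variable k : closedFieldType.

Fact is_cocycle1 (T : finGroupType) (L : {set T}) :
  is_cocycle L (fun _ _ => 1 : k).
Proof. by split=> // x y _ _; rewrite oner_eq0. Qed.

Definition trivial_pair (T : finGroupType) (L : {group T}) : twisted_pair k T :=
  mk_twisted_pair (@is_cocycle1 T L).

Definition basis_elt (T : finGroupType) (c : twisted_class k T) :
    {ffun twisted_class k T -> int} :=
  [ffun z => (z == c)%:R].

Definition B (G H : finGroupType) : Type :=
  {ffun twisted_class k (G * H)%type -> int}.
HB.instance Definition _ (G H : finGroupType) := GRing.Zmodule.on (B G H).

Section Basis.

Variables G H K : finGroupType.
Implicit Types (p : twisted_pair k (G * H)%type)
  (q : twisted_pair k (H * K)%type) (g : H).

(* M^g = (g,1) M (g,1)^-1; in MathComp x ^ y is y^-1 * x * y. *)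
Definition conjM q g : {set H * K} := (tgroup q :^ (g, 1)^-1)%g.
Definition conj_nu q g (x y : H * K) : k :=
  tcocycle q (x ^ (g, 1))%g (y ^ (g, 1))%g.

Definition star_group p q g : {set (G * H) * (H * K)} :=
  [set f | [&& f.1 \in tgroup p, f.2 \in conjM q g & f.1.2 == f.2.1]]%SET.
Definition star_map (f : (G * H) * (H * K)) : (G * K)%type := (f.1.1, f.2.2).
Definition star_cocycle p q g (f f' : (G * H) * (H * K)) : k :=
  tcocycle p f.1 f'.1 * conj_nu q g f.2 f'.2.
Definition star_ker p q g : {set H} :=
  [set b | ((1, b) \in tgroup p) && ((b, 1) \in conjM q g)]%g%SET.
Definition star_ker_emb (b : H) : (G * H) * (H * K) := ((1, b), (b, 1))%g.

(* lambda_pi exists by Schur's lemma and its class does not depend on pi or on *)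
(* the c_n, so the default value of xget is never used when X is in Irr.      *)
Definition clifford_class p q g (X : set (tg_rep k H)) :
    twisted_class k (G * K)%type :=
  class_of (xget (trivial_pair 1%G)
    (clifford_pair (star_group p q g) (star_cocycle p q g) star_map
       (star_ker p q g) star_ker_emb X)).

(* The sum over N_g \ Irr(A_g).  It is a finitely supported sum: Irr(A_g) is  *)
(* finite because A_g is finite-dimensional.                                  *)
Definition clifford_sum p q g : B G K :=
  \sum_(O \in irr_orbits (star_group p q g) (star_cocycle p q g) star_map
                 (star_ker p q g) star_ker_emb)
     basis_elt (clifford_class p q g (xget set0 O)).

Definition double_cosets p q : {set {set H}} :=
  [set [set x.2 | x in tgroup p] :* g * [set y.1 | y in tgroup q] | g : H]%g%SET.

Definition comp_basis (a : twisted_class k (G * H)%type)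
    (b : twisted_class k (H * K)%type) : B G K :=
  let p := class_repr a in let q := class_repr b in
  \sum_(D in double_cosets p q) clifford_sum p q (fingroup.repr D).

Definition comp (x : B G H) (y : B H K) : B G K :=
  \sum_a \sum_b comp_basis a b *~ (x a * y b).

End Basis.

Lemma comp_is_zmod_morphism (G H K : finGroupType) (x : B G H) :
  zmod_morphism (@comp G H K x).
Proof.
move=> y z; rewrite /comp -sumrB; apply: eq_bigr => a _.
rewrite -sumrB; apply: eq_bigr => b _.
by rewrite !ffunE mulrBr mulrzBr.
Qed.

Fact diag_group_set (G : finGroupType) :
  group_set [set x : G * G | x.1 == x.2]%SET.
Proof.
apply/group_setP; split=> [|x y]; rewrite !inE//.
by move=> /eqP + /eqP => /= -> ->.
Qed.
Definition diag_group (G : finGroupType) : {group G * G} :=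
  Group (diag_group_set G).

Definition unit_elt (G : finGroupType) : B G G :=
  basis_elt (class_of (trivial_pair (diag_group G))).

Fact swap_group_set (G H : finGroupType) (L : {group G * H}) :
  group_set [set x : H * G | (x.2, x.1) \in L]%SET.
Proof.
apply/group_setP; split=> [|x y]; rewrite !inE; first exact: group1.
by move=> xL yL; have := groupM xL yL.
Qed.
Definition swap_group (G H : finGroupType) (L : {group G * H}) : {group H * G} :=
  Group (swap_group_set L).

Fact dual_cocycle (G H : finGroupType) (p : twisted_pair k (G * H)%type) :
  is_cocycle (swap_group (tgroup p))
    (fun x y => (tcocycle p (x.2, x.1) (y.2, y.1))^-1).
Proof.
have [mu0 mu1 muM] := tcocycleP p; split.
- by move=> x y; rewrite !inE => xL yL; rewrite invr_neq0 ?mu0.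
- move=> x; rewrite !inE => xL.
  by have [m1 m2] := mu1 _ xL; split; rewrite ?[tcocycle _ _ _]m1 ?[tcocycle _ _ _]m2 invr1.
- move=> x y z; rewrite !inE => xL yL zL.
  by rewrite -!invfM; congr (_^-1); have := muM _ _ _ xL yL zL.
Qed.

Definition dual_pair (G H : finGroupType) (p : twisted_pair k (G * H)%type) :
    twisted_pair k (H * G)%type :=
  mk_twisted_pair (dual_cocycle p).

Definition dual_class (G H : finGroupType) (a : twisted_class k (G * H)%type) :
    twisted_class k (H * G)%type :=
  class_of (dual_pair (class_repr a)).

End Composition.

Section Representation.

Variables (k : closedFieldType) (G : finGroupType).

Definition Omega : finType := twisted_class k (G * unit)%type.

Definition rho (x : B k G G) : B k G unit -> B k G unit := comp x.
HB.instance Definition _ (x : B k G G) :=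
  GRing.isZmodMorphism.Build (B k G unit) (B k G unit) (rho x)
    (comp_is_zmod_morphism x).

Definition in_ker_rho (x : B k G G) : Prop := forall y, rho x y = 0.

Definition E_elt (a b : Omega) : B k G G := comp_basis a (dual_class b).

(* The group B(1,1) is identified with the integers by its only basis element *)
(* [1,1].                                                                     *)
Definition B11_int (x : B k unit unit) : int := x (class_of (trivial_pair k 1%G)).

Definition comp_coef (b c : Omega) : int :=
  B11_int (comp_basis (dual_class b) c).

(* Omega is ordered by its enumeration. *)
Definition comp_mx : 'M[int]_#|Omega| :=
  \matrix_(i, j) comp_coef (enum_val i) (enum_val j).

Definition J_of_mx (M : 'M[int]_#|Omega|) : B k G G :=
  \sum_i \sum_j E_elt (enum_val i) (enum_val j) *~ M i j.

Definition in_J (x : B k G G) : Prop := exists M, x = J_of_mx M.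

Definition QR : Type := {ffun twisted_class k (G * G)%type -> rat^o}.
HB.instance Definition _ := Vector.on QR.

Definition to_QR (x : B k G G) : QR := [ffun c => (x c)%:~R].

Definition QR_mul (x y : QR) : QR :=
  \sum_a \sum_b (x a * y b : rat) *: to_QR (comp_basis a b).

Definition QE_tuple : #|{: Omega * Omega}|.-tuple QR :=
  [tuple to_QR (E_elt (enum_val i).1 (enum_val i).2)
     | i < #|{: Omega * Omega}|].

(* Q (x) J_G, as the Q-span of J_G in Q (x) R_G: R_G is free. *)
Definition QJ : {vspace QR} := <<QE_tuple>>%VS.

(* The matrix of coordinates of an element of QJ in the E_{a,b}. *)
Definition QJ_mx (x : QR) : 'M[rat]_#|Omega| :=
  \matrix_(i, j) coord QE_tuple (enum_rank (enum_val i, enum_val j)) x.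

Definition QOmega : Type := {ffun Omega -> rat^o}.
HB.instance Definition _ := Vector.on QOmega.

(* Matrices act on coordinate columns, so that X * comp_mx is the matrix of    *)
(* left composition by X.                                                     *)
Definition End_of_mx (M : 'M[rat]_#|Omega|) : 'End(QOmega) :=
  linfun (fun y : QOmega => [ffun a =>
    \sum_(b : Omega) M (enum_rank a) (enum_rank b) * (y b : rat)] : QOmega).

Definition QJ_to_End (x : QR) : 'End(QOmega) :=
  End_of_mx (QJ_mx x *m map_mx intr comp_mx).

End Representation.

(* Main.v *)
(* A basis element [A x B, alpha x beta] of B(G,H) composes with [C x D, gamma x
   delta] to a multiple of [A x D, alpha x delta]: each algebra k_eta[F_g] is then,
   up to rescaling its basis, a tensor product of k[A x D] with the algebra A_g,
   so the grading group acts trivially on Irr(A_g), and the multiplicity depends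
   only on (B, beta) and (C, gamma).  Every basis element of B(G,1) and B(1,G),
   hence every E_{a,b}, is such a product.  Comparing multiplicities gives
   E_{a,b} c = c_{b,c} a and E_{a,b} E_{c,d} = c_{b,c} E_{a,d} without any general
   associativity, so an X in J_G acts on Omega_G by the matrix X C_G.  If C_G is
   singular, a row vector in its left kernel gives a kernel element; otherwise
   d 1_G - X_d acts by zero, and it is nonzero since the diagonal of a nontrivial
   group is not a product of subgroups. *)
Require Import Defs.
From HB Require Import structures.
From mathcomp Require Import all_boot all_order all_algebra all_fingroup.
From mathcomp Require Import boolp classical_sets functions cardinality fsbigop ring.
Import Defs.

Set Implicit Arguments.
Unset Strict Implicit.
Unset Printing Implicit Defensive.

Import GRing.Theory.

Local Open Scope ring_scope.

(** * Modules over twisted group algebras *)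

(** The obstacle is that [clifford_sum] rests on arbitrary choices: elements of [Irr] are sets of
    representations, the Clifford cocycle is any one that fits some maps c_n, and [class_repr] of a
    product class is only conjugate to a product, with a cocycle that is a product up to a
    coboundary. That coboundary is the source of the rescaling. Triviality of the action is shown by
    an explicit map: u_(n,b) tensor v goes to psi(n,b) times b v, and identifies the degree n part
    tensored with V with V itself. These maps compose with a defect equal to the cocycle on N, which
    is therefore a Clifford cocycle; Schur's lemma handles all other choices. The sizes of [Irr] are
    compared by transporting modules, and only the one for the trivial group is computed.
    Composition with [Delta(G),1] is again a split situation, with K trivial and N conjugate to the
    group of the other factor. For faithfulness, the adjugate solves M C = det C over the integers,
    so d = det C, of either sign, already gives a kernel element when C is nonsingular and G is
    nontrivial. *)

Section MatrixOfLinear.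

Variable k : fieldType.

Lemma linear_mulmx m n (f : 'cV[k]_m -> 'cV[k]_n) :
  linear f -> exists P : 'M[k]_(n, m), forall v, f v = P *m v.
Proof.
move=> flin.
pose fL : {linear 'cV[k]_m -> 'cV[k]_n} :=
  HB.pack f (GRing.isLinear.Build _ _ _ _ f flin).
exists (\matrix_(i, j) f (delta_mx j 0) i 0) => v.
rewrite {1}(matrix_sum_delta v) -[f]/(fL : _ -> _) linear_sum /=.
apply/colP => i; rewrite !mxE summxE; apply: eq_bigr => j _.
by rewrite big_ord1 -[f]/(fL : _ -> _) linearZ /= !mxE mulrC.
Qed.

(** A section of [P] chosen pointwise is linear because [P] is injective. The sizes may differ a
    priori: in [split_action_universal] they are the dimensions of two modules not yet known to be
    isomorphic. *)
Lemma bijective_mulmx_inv m n (P : 'M[k]_(n, m)) :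
    (forall v : 'cV_m, P *m v = 0 -> v = 0) ->
    (forall w : 'cV_n, exists v : 'cV_m, P *m v = w) ->
  exists Q, Q *m P = 1%:M /\ P *m Q = 1%:M.
Proof.
move=> Pinj /choice[s sE].
have [|Q QE] := @linear_mulmx n m s.
  move=> a u v; apply/eqP; rewrite -subr_eq0; apply/eqP/Pinj.
  by rewrite mulmxBr mulmxDr -scalemxAr !sE subrr.
have PQ : P *m Q = 1%:M.
  apply/matrixP => i j; have := sE (delta_mx j 0).
  rewrite QE mulmxA => /matrixP/(_ i 0).
  by rewrite -colE !mxE eqxx andbT => ->.
exists Q; split=> //; apply/matrixP => i j.
have : (Q *m P - 1%:M) *m delta_mx j 0 = 0 :> 'cV_m.
  by apply: Pinj; rewrite mulmxA mulmxBr mulmxA PQ mul1mx mulmx1 subrr mul0mx.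
move=> /matrixP/(_ i 0); rewrite -colE [LHS]mxE [LHS]mxE [X in _ + X]mxE [RHS]mxE.
by move/eqP; rewrite subr_eq0 => /eqP.
Qed.

End MatrixOfLinear.

Section TwistedGroupAlgebraTheory.

Variables (k : fieldType) (T : finGroupType).
Implicit Types (F : {set T}) (eta : T -> T -> k) (a b : {ffun T -> k^o}).

Lemma tg_sum_basis a : a = \sum_z (a z : k) *: tg_basis k z.
Proof.
apply/ffunP => z; rewrite sum_ffunE (bigD1 z)//= big1 => [|y yz].
  by rewrite !ffunE eqxx addr0 [RHS]mulr1.
by rewrite !ffunE eq_sym (negPf yz) [LHS]mulr0.
Qed.

Lemma tg_basis_span F x : x \in F -> tg_basis k x \in tg_span k F.
Proof. by move=> xF; apply: memv_span; apply: map_f; rewrite mem_enum. Qed.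

Lemma tg_span_out F a z : a \in tg_span k F -> z \notin F -> a z = 0.
Proof.
move=> aF zF; rewrite (coord_span aF) sum_ffunE big1// => i _.
rewrite ffunE.
have /mapP[y] : [seq tg_basis k x | x <- enum F]`_i
    \in [seq tg_basis k x | x <- enum F].
  by apply: mem_nth; rewrite size_map -cardE ltn_ord.
rewrite mem_enum => yF ->; rewrite ffunE.
case: eqP => [zy|_]; first by rewrite zy yF in zF.
exact: mulr0.
Qed.

Lemma tg_spanE F a : a \in tg_span k F -> a = \sum_(z in F) (a z : k) *: tg_basis k z.
Proof.
move=> aF; rewrite {1}[a]tg_sum_basis [RHS]big_mkcond; apply: eq_bigr => z _.
by case: ifPn => // zF; rewrite (tg_span_out aF zF) scale0r.
Qed.

(** Reduces identities between linear expressions to basis elements. Linearity is asked of bare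
    functions, so that [f] and [g] can be read off a goal such as a product of actions or a pure
    tensor. *)
Lemma tg_span_ext F (W : lmodType k) (f g : {ffun T -> k^o} -> W) :
    linear f -> linear g -> {in F, forall z, f (tg_basis k z) = g (tg_basis k z)} ->
  {in tg_span k F, f =1 g}.
Proof.
move=> flin glin fg a /tg_spanE ->.
pose fL : {linear {ffun T -> k^o} -> W} :=
  HB.pack f (GRing.isLinear.Build _ _ _ _ f flin).
pose gL : {linear {ffun T -> k^o} -> W} :=
  HB.pack g (GRing.isLinear.Build _ _ _ _ g glin).
rewrite -[f]/(fL : _ -> _) -[g]/(gL : _ -> _) !linear_sum.
by apply: eq_bigr => z zF; rewrite !linearZ /= fg.
Qed.

Lemma tg_span_stable F (W : vectType k) (U : {vspace W}) (f : {ffun T -> k^o} -> W) :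
    linear f -> {in F, forall z, f (tg_basis k z) \in U} ->
  {in tg_span k F, forall a, f a \in U}.
Proof.
move=> flin fU a /tg_spanE ->.
pose fL : {linear {ffun T -> k^o} -> W} :=
  HB.pack f (GRing.isLinear.Build _ _ _ _ f flin).
rewrite -[f]/(fL : _ -> _) linear_sum; apply: memv_suml => z zF.
by rewrite linearZ memvZ//= fU.
Qed.

Lemma tg_mul_linearl eta b : linear (fun a => tg_mul eta a b).
Proof.
move=> c a a'; rewrite /tg_mul scaler_sumr -big_split /=; apply: eq_bigr => x _.
rewrite scaler_sumr -big_split /=; apply: eq_bigr => y _.
by rewrite scalerA -scalerDl !ffunE; congr (_ *: _); rewrite /GRing.scale /=; ring.
Qed.

Lemma tg_mul_linearr eta a : linear (tg_mul eta a).
Proof.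
move=> c b b'; rewrite /tg_mul scaler_sumr -big_split /=; apply: eq_bigr => x _.
rewrite scaler_sumr -big_split /=; apply: eq_bigr => y _.
by rewrite scalerA -scalerDl !ffunE; congr (_ *: _); rewrite /GRing.scale /=; ring.
Qed.

Lemma tg_mul_basis eta x y :
  tg_mul eta (tg_basis k x) (tg_basis k y) = eta x y *: tg_basis k (x * y)%g.
Proof.
rewrite /tg_mul (bigD1 x)//= (bigD1 y)//= !ffunE !eqxx !mul1r.
rewrite big1 => [|z zy]; last by rewrite !ffunE (negPf zy) mulr0 mul0r scale0r.
rewrite addr0 big1 ?addr0// => z zx; rewrite big1// => u _.
by rewrite !ffunE (negPf zx) !mul0r scale0r.
Qed.

Lemma ract_linear (V : tg_rep k T) : linear (ract V).
Proof. exact: linearP. Qed.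

Lemma ractZ (V : tg_rep k T) c a : ract V (c *: a) = c *: ract V a.
Proof. exact: linearZ. Qed.

End TwistedGroupAlgebraTheory.

Section EmbeddingAndTensor.

Variables (k : fieldType) (T H : finGroupType).

Lemma tg_emb_linear (K : {set H}) (iota : H -> T) : linear (@tg_emb k T H K iota).
Proof.
move=> c a b; rewrite /tg_emb scaler_sumr -big_split; apply: eq_bigr => x _.
by rewrite /= scalerA -scalerDl !ffunE.
Qed.

Lemma tg_emb_basis (K : {set H}) (iota : H -> T) b : b \in K ->
  tg_emb K iota (tg_basis k b) = tg_basis k (iota b).
Proof.
move=> bK; rewrite /tg_emb (bigD1 b)//= big1 => [|c /andP[_ cb]].
  by rewrite ffunE eqxx scale1r addr0.
by rewrite ffunE (negPf cb) scale0r.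
Qed.

Lemma pure_tensor_linearl (V : tg_rep k H) (v : 'cV[k]_(rdim V)) :
  linear (fun x : {ffun T -> k^o} => pure_tensor x v).
Proof.
move=> c x y; apply/ffunP => f.
by rewrite !ffunE scalerA -scalerDl.
Qed.

Lemma pure_tensor_linearr (V : tg_rep k H) (x : {ffun T -> k^o}) :
  linear (@pure_tensor k T H V x).
Proof.
move=> c u v; apply/ffunP => f.
by rewrite !ffunE scalerDr !scalerA mulrC.
Qed.

End EmbeddingAndTensor.

Section Modules.

Variables (k : fieldType) (T : finGroupType) (K : {set T}) (alpha : T -> T -> k).
Implicit Types V W : tg_rep k T.

Lemma module_iso_refl V : module_iso K V V.
Proof. by exists 1%:M, 1%:M; split=> [||a _]; rewrite !(mul1mx, mulmx1). Qed.

Lemma module_iso_sym V W : module_iso K V W -> module_iso K W V.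
Proof.
move=> [P [Q [QP PQ PE]]]; exists Q, P; split=> // a aK.
by rewrite -[LHS]mulmx1 -PQ mulmxA -[Q *m _ *m P]mulmxA -PE// !mulmxA QP mul1mx.
Qed.

Lemma module_iso_trans W V Z :
  module_iso K V W -> module_iso K W Z -> module_iso K V Z.
Proof.
move=> [P [Q [QP PQ PE]]] [P' [Q' [QP' PQ' PE']]].
exists (P' *m P), (Q *m Q'); split.
- by rewrite mulmxA -(mulmxA Q) QP' mulmx1.
- by rewrite mulmxA -(mulmxA P') PQ mulmx1.
- by move=> a aK; rewrite -mulmxA PE// mulmxA PE'// mulmxA.
Qed.

Lemma iso_class_eq V W :
  is_simple K alpha V -> is_simple K alpha W ->
  iso_class K alpha V = iso_class K alpha W <-> module_iso K V W.
Proof.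
move=> Vs Ws; split=> [E|VW].
  have : iso_class K alpha W W by split => //; exact: module_iso_refl.
  by rewrite -E => -[].
apply/seteqP; split=> Z [Zs ZE]; split=> //.
  exact: module_iso_trans (module_iso_sym VW) ZE.
exact: module_iso_trans VW ZE.
Qed.

End Modules.

(** Algebraic closedness gives [P] an eigenvalue [c], and the kernel of [P - c%:M] is a nonzero
    submodule, hence everything. The transposes appear because [eigenvalue] concerns row vectors. *)
Lemma schur (k : closedFieldType) (T : finGroupType) (K : {set T})
    (alpha : T -> T -> k) (V : tg_rep k T) (P : 'M[k]_(rdim V)) :
    is_simple K alpha V ->
    {in tg_span k K, forall a, P *m ract V a = ract V a *m P} ->
  exists c, P = c%:M.
Proof.
move=> [_ Vgt0 Vs] Pcomm.
have [c croot] : exists c, root (char_poly P^T) c.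
  by apply/closed_rootP; rewrite size_char_poly eqSS -lt0n.
have /eigenvalueP[v vE v0] : eigenvalue P^T c by rewrite eigenvalue_root_char.
exists c.
pose U := lker (linfun (mulmx (P - c%:M) : 'cV[k]_(rdim V) -> 'cV[k]_(rdim V))).
have memU w : (w \in U) = ((P - c%:M) *m w == 0) by rewrite memv_ker lfunE.
have [a w aK|U0|Ufull] := Vs U.
- rewrite !memU => /eqP wU.
  by rewrite mulmxA mulmxBl Pcomm// -scalar_mxC -mulmxBr -mulmxA wU mulmx0.
- have : v^T \in U.
    rewrite memU mulmxBl mul_scalar_mx -[P]trmxK -trmx_mul vE.
    by rewrite linearZ /= subrr.
  rewrite U0 memv0 => /eqP/(congr1 trmx); rewrite trmxK trmx0 => vz.
  by rewrite vz eqxx in v0.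
- apply/eqP; rewrite -subr_eq0; apply/eqP/matrixP => i j0.
  have : delta_mx j0 0 \in U by rewrite Ufull memvf.
  by rewrite memU -colE => /eqP/matrixP/(_ i 0); rewrite [LHS]mxE => ->; rewrite !mxE.
Qed.

(* When P is infinite both sums take the default value 0, so the finiteness of *)
(* Irr is never needed.                                                       *)
Lemma fsumr_const (I : choiceType) (V : zmodType) (P : set I) (c : V) :
  \sum_(i \in P) c = c *~ \sum_(i \in P) (1 : int).
Proof.
have [->|c0] := eqVneq c 0; first by rewrite fsbig1// mul0rz.
have [fP|nP] := pselect (finite_set P).
  by rewrite !fsbig_finite//= mulrz_sumr; apply: eq_bigr => i _; rewrite mulr1z.
rewrite !no_finite_support ?big_nil ?mulr0z// => h; apply: nP.
  by apply: sub_finite_set h => i Pi; split.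
by apply: sub_finite_set h => i Pi; split => //; exact/eqP.
Qed.

Definition irr_count (k : fieldType) (T : finGroupType) (K : {set T})
    (alpha : T -> T -> k) : int :=
  \sum_(X \in Irr K alpha) (1 : int).

(** * Transport of simple modules along isomorphisms of twisted group algebras *)

Section Transport.

Variables (k : fieldType) (T T' : finGroupType).
Variables (K : {group T}) (K' : {group T'}).
Variables (alpha : T -> T -> k) (alpha' : T' -> T' -> k).
Variables (th : T -> T') (om : T -> k).

Hypothesis thK : {in K, forall x, th x \in K'}.
Hypothesis th_inj : {in K &, injective th}.
Hypothesis th_surj : {in K', forall x', exists2 x, x \in K & x' = th x}.
Hypothesis thM : {in K &, forall x y, th (x * y)%g = (th x * th y)%g}.
Hypothesis om_neq0 : {in K, forall x, om x != 0}.
Hypothesis om1 : om 1%g = 1.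
Hypothesis alphaE : {in K &, forall x y,
  alpha' (th x) (th y) = alpha x y * (om x * om y / om (x * y)%g)}.

Implicit Types V W : tg_rep k T.

(** Pullback of [V] along the algebra isomorphism from k_alpha'[K'] to k_alpha[K] sending u_(th b)
    to om(b) u_b. *)
Definition transport V : tg_rep k T' :=
  Tagged (fun d => 'Hom({ffun T' -> k^o}, 'M[k]_d))
    (linfun (fun a : {ffun T' -> k^o} =>
      \sum_(b in K) (a (th b) * om b : k) *: ract V (tg_basis k b) : 'M_(rdim V))).

Let transportE V (a : {ffun T' -> k^o}) : ract (transport V) a =
  \sum_(b in K) (a (th b) * om b : k) *: ract V (tg_basis k b) :> 'M_(rdim V).
Proof.
pose f (a : {ffun T' -> k^o}) : 'M_(rdim V) :=
  \sum_(b in K) (a (th b) * om b : k) *: ract V (tg_basis k b).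
have flin : linear f.
  move=> c s s'; rewrite /f scaler_sumr -big_split; apply: eq_bigr => b _ /=.
  by rewrite !ffunE scalerA -scalerDl mulrDl mulrA.
pose fL : {linear {ffun T' -> k^o} -> 'M[k]_(rdim V)} :=
  HB.pack f (GRing.isLinear.Build _ _ _ _ f flin).
exact: (lfunE fL a).
Qed.

Lemma transport_basis V b : b \in K ->
  ract (transport V) (tg_basis k (th b)) = om b *: ract V (tg_basis k b).
Proof.
move=> bK; rewrite transportE (bigD1 b)//= big1 => [|c /andP[cK cb]].
  by rewrite ffunE eqxx mul1r addr0.
rewrite ffunE (_ : _ == _ = false) ?mul0r ?scale0r//.
by apply: contraNF cb => /eqP/th_inj ->.
Qed.

Let th1 : th 1%g = 1%g.
Proof. by apply: (mulgI (th 1%g)); rewrite -thM// !mulg1. Qed.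

Let ext_K' (W : lmodType k) (f g : {ffun T' -> k^o} -> W) :
    linear f -> linear g ->
    {in K, forall z, f (tg_basis k (th z)) = g (tg_basis k (th z))} ->
  {in tg_span k K', f =1 g}.
Proof.
move=> fl gl fg; apply: tg_span_ext => // x' /th_surj[x xK ->]; exact: fg.
Qed.

Lemma transport_module V : is_module K alpha V -> is_module K' alpha' (transport V).
Proof.
move=> [V1 VM]; split.
  by rewrite -th1 transport_basis// om1 scale1r.
move=> a b aK; move: b; apply: ext_K' => [c x y|c x y|y yK].
- by rewrite tg_mul_linearr ract_linear.
- by rewrite ract_linear mulmxDr -scalemxAr.
move: a aK; apply: ext_K' => [c x x'|c x x'|x xK].
- by rewrite tg_mul_linearl ract_linear.
- by rewrite ract_linear mulmxDl -scalemxAl.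
rewrite tg_mul_basis -thM// ractZ !transport_basis ?groupM//.
rewrite -[rdim (transport V)]/(rdim V) -scalemxAl -scalemxAr -VM ?tg_basis_span//.
rewrite tg_mul_basis ractZ !scalerA alphaE//.
congr (_ *: _); field; exact: om_neq0 (groupM xK yK).
Qed.

Lemma transport_simple V : is_simple K alpha V -> is_simple K' alpha' (transport V).
Proof.
move=> [Vm Vgt0 Vs]; split=> [||U UP]; [exact: transport_module|exact: Vgt0|].
apply: Vs => a v aK vU; rewrite (tg_spanE aK).
rewrite -[ract V]/(tagged V : _ -> _) linear_sum mulmx_suml.
apply: memv_suml => b bK; rewrite linearZ /= -scalemxAl memvZ//.
have := UP _ v (tg_basis_span _ (thK bK)) vU.
rewrite transport_basis// -[rdim (transport V)]/(rdim V) -scalemxAl => /(memvZ (om b)^-1).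
by rewrite scalerA mulVf ?om_neq0// scale1r.
Qed.

(** The space is unchanged and basis elements act as before up to nonzero scalars, so the same
    matrices intertwine. *)
Lemma transport_iso V W :
  module_iso K V W <-> module_iso K' (transport V) (transport W).
Proof.
split=> -[P [Q [QP PQ PE]]]; exists P, Q; split=> //.
  apply: ext_K' => [c x y|c x y|x xK].
  - by rewrite ract_linear mulmxDr -scalemxAr.
  - by rewrite ract_linear mulmxDl -scalemxAl.
  rewrite !transport_basis// -[rdim (transport V)]/(rdim V).
  by rewrite -[rdim (transport W)]/(rdim W) -scalemxAl -scalemxAr PE ?tg_basis_span.
apply: tg_span_ext => [c x y|c x y|x xK].
- by rewrite ract_linear mulmxDr -scalemxAr.
- by rewrite ract_linear mulmxDl -scalemxAl.
have := PE _ (tg_basis_span _ (thK xK)).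
rewrite !transport_basis// -[rdim (transport V)]/(rdim V).
rewrite -[rdim (transport W)]/(rdim W) -scalemxAr -scalemxAl.
by move/(scalerI (om_neq0 xK)).
Qed.

End Transport.

Section TransportCount.

Variables (k : fieldType) (T T' : finGroupType).
Variables (K : {group T}) (K' : {group T'}).
Variables (alpha : T -> T -> k) (alpha' : T' -> T' -> k).
Variables (th : T -> T') (th' : T' -> T) (om : T -> k).

Hypothesis thK : {in K, forall x, th x \in K'}.
Hypothesis th'K : {in K', forall x, th' x \in K}.
Hypothesis thC : {in K, cancel th th'}.
Hypothesis th'C : {in K', cancel th' th}.
Hypothesis thM : {in K &, forall x y, th (x * y)%g = (th x * th y)%g}.
Hypothesis om_neq0 : {in K, forall x, om x != 0}.
Hypothesis om1 : om 1%g = 1.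
Hypothesis alphaE : {in K &, forall x y,
  alpha' (th x) (th y) = alpha x y * (om x * om y / om (x * y)%g)}.

Lemma irr_count_transport : irr_count K alpha = irr_count K' alpha'.
Proof.
pose tr := transport K th om.
(* The inverse isomorphism sends u_b to om(b)^-1 u_(th b), which is the transport datum for
   [th']. *)
pose om' x := (om (th' x))^-1.
pose tr' : tg_rep k T' -> tg_rep k T := transport K' th' om'.
have th1 : th 1%g = 1%g by apply: (mulgI (th 1%g)); rewrite -thM// !mulg1.
have th'1 : th' 1%g = 1%g by rewrite -th1 thC.
have thI : {in K &, injective th}.
  by move=> x y xK yK xy; rewrite -(thC xK) xy thC.
have th'I : {in K' &, injective th'}.
  by move=> x y xK yK xy; rewrite -(th'C xK) xy th'C.
have thS : {in K', forall x', exists2 x, x \in K & x' = th x}.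
  by move=> x xK; exists (th' x); rewrite ?th'C ?th'K.
have th'S : {in K, forall x', exists2 x, x \in K' & x' = th' x}.
  by move=> x xK; exists (th x); rewrite ?thC ?thK.
have th'M : {in K' &, forall x y, th' (x * y)%g = (th' x * th' y)%g}.
  move=> x y xK yK; apply: thI; rewrite ?groupM ?th'K ?groupM//.
  by rewrite thM ?th'K// !th'C ?groupM.
have om'0 : {in K', forall x, om' x != 0}.
  by move=> x xK; rewrite invr_neq0// om_neq0// th'K.
have om'1 : om' 1%g = 1 by rewrite /om' th'1 om1 invr1.
have alpha'E : {in K' &, forall x y,
    alpha (th' x) (th' y) = alpha' x y * (om' x * om' y / om' (x * y)%g)}.
  move=> x y xK yK; rewrite -{2}(th'C xK) -{2}(th'C yK) alphaE ?th'K// /om' th'M//.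
  by field; rewrite !om_neq0 ?groupM ?th'K ?oner_eq0.
have trS V := transport_simple thK thI thS thM om_neq0 om1 alphaE (V := V).
have tr'S V := transport_simple th'K th'I th'S th'M om'0 om'1 alpha'E (V := V).
have trI V W := transport_iso thK thI thS om_neq0 V W.
have tr'C V : module_iso K' (tr (tr' V)) V.
  exists 1%:M, 1%:M; split; rewrite ?mul1mx//.
  apply: tg_span_ext => [c x y|c x y|x' x'K].
  - by rewrite ract_linear mulmxDr -scalemxAr.
  - by rewrite ract_linear mulmxDl -scalemxAl.
  rewrite -{1}(th'C x'K) /tr transport_basis ?th'K// transport_basis//.
  by rewrite scalerA mulfV ?om_neq0 ?th'K// scale1r mul1mx mulmx1.
rewrite /irr_count.
(* Elements of [Irr] are sets, so [F] takes every simple module isomorphic to a transported member;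
   this avoids choosing a representative. *)
pose F (X : set (tg_rep k T)) : set (tg_rep k T') :=
  [set W | is_simple K' alpha' W /\ exists2 V, X V & module_iso K' (tr V) W]%classic.
have FE V : is_simple K alpha V -> F (iso_class K alpha V) = iso_class K' alpha' (tr V).
  move=> Vs; apply/seteqP; split=> W [Ws].
    move=> [V' [V's VV'] V'W]; split=> //.
    by apply: module_iso_trans V'W; exact/trI.
  by move=> VW; split=> //; exists V => //; split=> //; exact: module_iso_refl.
apply/esym/(@reindex_fsbig _ _ _ _ _ F); split.
- by move=> X [V Vs ->]; rewrite /= FE//; exists (tr V) => //; exact: trS.
- move=> X Y; rewrite !inE => -[V Vs ->] [W Ws ->]; rewrite !FE//.
  move=> /(iso_class_eq (trS _ Vs) (trS _ Ws)) /trI VW.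
  exact/iso_class_eq.
- move=> Y [W Ws ->]; exists (iso_class K alpha (tr' W)).
    by exists (tr' W) => //; exact: tr'S.
  rewrite FE; last exact: tr'S.
  by apply/iso_class_eq => //; exact/trS/tr'S.
Qed.

End TransportCount.

Lemma irr_count_trivial (k : fieldType) (T : finGroupType) (K : {set T})
  (alpha : T -> T -> k) : K = 1%g -> alpha 1%g 1%g = 1 -> irr_count K alpha = 1.
Proof.
move=> -> a1.
have span1 a : a \in tg_span k (1%g : {set T}) -> a = (a 1%g : k) *: tg_basis k 1%g.
  by move=> /tg_spanE {1}->; rewrite -[1%g : {set T}]/[set 1%g]%SET big_set1.
pose f1 (a : {ffun T -> k^o}) : 'M[k]_1 := (a 1%g : k)%:M.
have f1lin : linear f1.
  by move=> c a b; apply/matrixP => i j; rewrite !mxE !ffunE mulrnDl mulrnAr.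
pose f1L : {linear {ffun T -> k^o} -> 'M[k]_1} :=
  HB.pack f1 (GRing.isLinear.Build _ _ _ _ f1 f1lin).
pose V : tg_rep k T := Tagged (fun d => 'Hom({ffun T -> k^o}, 'M[k]_d)) (linfun f1L).
have VE a : ract V a = (a 1%g : k)%:M :> 'M_1 by rewrite /ract lfunE.
have Vm : is_module (1%g : {set T}) alpha V.
  split; first by rewrite VE ffunE eqxx.
  have in1 z : z \in (1%g : {set T}) -> z = 1%g by move/set1gP.
  move=> a b aK; move: b; apply: tg_span_ext => [c x y|c x y|y /in1 ->].
  - by rewrite tg_mul_linearr ract_linear.
  - by rewrite ract_linear mulmxDr -scalemxAr.
  move: a aK; apply: tg_span_ext => [c x y'|c x y'|x /in1 ->].
  - by rewrite tg_mul_linearl ract_linear.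
  - by rewrite ract_linear mulmxDl -scalemxAl.
  by rewrite tg_mul_basis a1 scale1r mulg1 VE ffunE eqxx mulmx1.
have Vs : is_simple (1%g : {set T}) alpha V.
  split=> // U _; have [->|U0] := eqVneq U 0%VS; first by left.
  right; apply/eqP; rewrite eqEsubv subvf /=; apply/subvP => w _.
  have v0 : vpick U 0 0 != 0 :> k.
    apply: contra_neq U0 => v0; apply/eqP; rewrite -vpick0; apply/eqP.
    by apply/matrixP => i j; rewrite !ord1 mxE.
  suff -> : w = (w 0 0 / vpick U 0 0 : k) *: vpick U by rewrite memvZ// memv_pick.
  by apply/matrixP => i j; rewrite !ord1 mxE divfK.
rewrite /irr_count.
suff -> : Irr (1%g : {set T}) alpha = [set iso_class (1%g : {set T}) alpha V]%classic.
  by rewrite fsbig_set1.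
apply/seteqP; split=> X; last by move=> ->; exists V.
move=> [W Ws ->] /=; apply/iso_class_eq => //; apply: module_iso_sym.
have [[W1 _] Wgt0 Wsub] := Ws.
have rW1 a : a \in tg_span k (1%g : {set T}) -> ract W a = (a 1%g : k)%:M.
  by move=> /span1 {1}->; rewrite ractZ W1 scale_scalar_mx mulr1.
(* The algebra acts by scalars, so the line through any nonzero vector is a submodule, and
   simplicity makes it the whole space. *)
have dW : rdim W = 1%N.
  pose v : 'cV[k]_(rdim W) := const_mx 1.
  have v0 : v != 0.
    apply: contraTneq Wgt0 => /matrixP; rewrite /v; case: (rdim W) => // d.
    by move=> /(_ 0 0); rewrite !mxE => /eqP; rewrite oner_eq0.
  have [a w aK wv|/eqP|vfull] := Wsub <[v]>%VS.
  - by rewrite rW1// mul_scalar_mx memvZ.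
  - by rewrite -dimv_eq0 dim_vline v0.
  - by have := congr1 (fun U => \dim U) vfull; rewrite dim_vline v0 dimvf /dim /= muln1.
case: W dW rW1 {Ws W1 Wgt0 Wsub} => d f /=; rewrite /rdim /= => dE; subst d => rW1.
exists (1%:M : 'M_(1,1)), (1%:M : 'M_(1,1)); split; rewrite ?mulmx1// => a aK.
by rewrite VE rW1// mul1mx mulmx1.
Qed.

(** * Clifford theory of a split extension *)

(* The standing situation is an algebra k_eta[F] that is, up to the rescaling  *)
(* psi of its basis, the tensor product of k_lam[N] and k_alpha[K]; j n b is   *)
(* the element of F with components n and b.                                   *)
Section SplitClifford.

Variables (k : closedFieldType) (T S H : finGroupType).
Variables (F : {set T}) (eta : T -> T -> k) (q : T -> S).
Variables (K : {group H}) (iota : H -> T).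
Variables (nu : twisted_pair k S).
Variables (j : S -> H -> T) (psi : S -> H -> k).

Local Notation N := (tgroup nu).
Local Notation lam := (tcocycle nu).
Let alpha (b b' : H) : k := eta (iota b) (iota b').

Hypothesis jF : {in N & K, forall n b, j n b \in F /\ q (j n b) = n}.
Hypothesis j_inj : {in N, forall n, {in K &, injective (j n)}}.
Hypothesis Fj : {in F, forall f, q f \in N /\ exists2 b, b \in K & f = j (q f) b}.
Hypothesis jM : {in N & N, forall n m, {in K & K, forall b c,
  (j n b * j m c = j (n * m) (b * c))%g}}.
Hypothesis iotaE : {in K, iota =1 j 1%g}.
Hypothesis psi_neq0 : {in N & K, forall n b, psi n b != 0}.
Hypothesis psi1 : {in K, forall b, psi 1%g b = 1}.
Hypothesis alpha1 : {in K, forall b, alpha 1%g b = 1 /\ alpha b 1%g = 1}.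
Hypothesis etaE : {in N & N, forall n m, {in K & K, forall b c,
  eta (j n b) (j m c)
    = lam n m * alpha b c * (psi n b * psi m c / psi (n * m)%g (b * c)%g)}}.

Implicit Types V W : tg_rep k H.
Local Notation u := (tg_basis k).
Local Notation pure := (@pure_tensor k T H _).
Local Notation emb := (tg_emb K iota).
Local Notation mult := (tg_mul eta).
Local Notation Irr_K := (Irr (K : {set H}) alpha).

Let lam1 n : n \in N -> lam 1%g n = 1 /\ lam n 1%g = 1.
Proof. by have [_ + _] := tcocycleP nu; apply. Qed.

Lemma split_quotient : [set q f | f in F]%SET = N.
Proof.
apply/setP => n; apply/imsetP/idP => [[f /Fj[qN _] ->]//|nN].
by have [jn qj] := jF nN (group1 K); exists (j n 1%g).
Qed.

Let degP n f : f \in [set f in F | q f == n]%SET -> exists2 b, b \in K & f = j n b.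
Proof. by rewrite inE => /andP[/Fj[_ [b bK fE]] /eqP <-]; exists b. Qed.

Let jdeg n b : n \in N -> b \in K -> j n b \in [set f in F | q f == n]%SET.
Proof. by move=> nN bK; have [jf qj] := jF nN bK; rewrite inE jf qj eqxx. Qed.

Let emb_u b : b \in K -> emb (u b) = u (j 1%g b).
Proof. by move=> bK; rewrite tg_emb_basis// iotaE. Qed.

Let u_mul n m b c : n \in N -> m \in N -> b \in K -> c \in K ->
  mult (u (j n b)) (u (j m c))
    = lam n m * alpha b c * (psi n b * psi m c / psi (n * m)%g (b * c)%g)
        *: u (j (n * m)%g (b * c)%g).
Proof. by move=> nN mN bK cK; rewrite tg_mul_basis etaE// jM. Qed.

Let emb_mul n b c : n \in N -> b \in K -> c \in K ->
  mult (emb (u b)) (u (j n c))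
    = alpha b c * (psi n c / psi n (b * c)%g) *: u (j n (b * c)%g).
Proof.
move=> nN bK cK; rewrite emb_u// u_mul// psi1// (lam1 nN).1 mul1g.
by rewrite !mul1r.
Qed.

Let mul_emb n b c : n \in N -> b \in K -> c \in K ->
  mult (u (j n b)) (emb (u c))
    = alpha b c * (psi n b / psi n (b * c)%g) *: u (j n (b * c)%g).
Proof.
move=> nN bK cK; rewrite emb_u// u_mul// psi1// (lam1 nN).2 mulg1.
by rewrite mul1r mulr1.
Qed.

(** The candidate for c_n, with target [V] itself: u_(j n b) tensor v goes to psi(n,b) u_b v. It is
    a sum over [K] because tensors are encoded as functions on [T]. *)
Definition split_action V (n : S) : 'Hom({ffun T -> 'cV[k]_(rdim V)}, 'cV[k]_(rdim V)) :=
  linfun (fun t : {ffun T -> 'cV[k]_(rdim V)} =>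
    \sum_(b in K) psi n b *: (ract V (u b) *m t (j n b)) : 'cV_(rdim V)).

Lemma split_actionE V n t :
  split_action V n t = \sum_(b in K) psi n b *: (ract V (u b) *m t (j n b)).
Proof.
pose f (t : {ffun T -> 'cV[k]_(rdim V)}) : 'cV_(rdim V) :=
  \sum_(b in K) psi n b *: (ract V (u b) *m t (j n b)).
have flin : linear f.
  move=> c s s'; rewrite /f scaler_sumr -big_split; apply: eq_bigr => b _ /=.
  by rewrite !ffunE mulmxDr scalerDr -scalemxAr !scalerA mulrC.
pose fL : {linear {ffun T -> 'cV[k]_(rdim V)} -> 'cV[k]_(rdim V)} :=
  HB.pack f (GRing.isLinear.Build _ _ _ _ f flin).
exact: (lfunE fL t).
Qed.

Lemma split_action_basis V n b v : n \in N -> b \in K ->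
  split_action V n (pure (u (j n b)) v) = psi n b *: (ract V (u b) *m v).
Proof.
move=> nN bK; rewrite split_actionE (bigD1 b)//= big1 => [|c /andP[cK cb]].
  by rewrite !ffunE eqxx scale1r addr0.
rewrite !ffunE (_ : _ == _ = false) ?scale0r ?mulmx0 ?scaler0//.
by apply: contraNF cb => /eqP /(j_inj nN cK bK) ->.
Qed.

Let module_mul V b c : is_module K alpha V -> b \in K -> c \in K ->
  ract V (u b) *m ract V (u c) = alpha b c *: ract V (u (b * c)%g).
Proof.
move=> [_ VM] bK cK; rewrite -VM ?tg_basis_span// tg_mul_basis.
by rewrite ractZ.
Qed.

Let pureZ V (c : k) x (v : 'cV[k]_(rdim V)) : pure (c *: x) v = c *: pure x v.
Proof. by apply/ffunP => f; rewrite !ffunE scalerA. Qed.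

(** This lets [split_action] descend to the tensor product over k_alpha[K]: the quotient of psi in
    [mul_emb] cancels against the weights. *)
Lemma split_action_balanced V n x a v : is_module K alpha V -> n \in N ->
    x \in tg_deg k F q n -> a \in tg_span k K ->
  split_action V n (pure (mult x (emb a)) v)
    = split_action V n (pure x (ract V a *m v)).
Proof.
move=> Vm nN xn aK; move: a aK x xn.
have h a : a \in tg_span k K -> {in K, forall b,
  split_action V n (pure (mult (u (j n b)) (emb a)) v)
    = split_action V n (pure (u (j n b)) (ract V a *m v))}.
  move=> aK b bK; move: a aK; apply: tg_span_ext => [c x y|c x y|c cK].
  - by rewrite tg_emb_linear tg_mul_linearr pure_tensor_linearl linearP.
  - by rewrite ract_linear mulmxDl -scalemxAl pure_tensor_linearr linearP.
  rewrite mul_emb// split_action_basis// mulmxA module_mul//.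
  rewrite pureZ linearZ /= split_action_basis ?groupM//.
  rewrite -scalemxAl !scalerA; congr (_ *: _).
  by field; exact: psi_neq0 (groupM bK cK).
move=> a aK; apply: tg_span_ext => [c x y|c x y|f /degP[b bK ->]].
- by rewrite tg_mul_linearl pure_tensor_linearl linearP.
- by rewrite pure_tensor_linearl linearP.
- exact: h.
Qed.

Lemma split_action_linear V n x a v : is_module K alpha V -> n \in N ->
    a \in tg_span k K -> x \in tg_deg k F q n ->
  split_action V n (pure (mult (emb a) x) v)
    = ract V a *m split_action V n (pure x v).
Proof.
move=> Vm nN aK xn; move: a aK x xn => a aK.
apply: tg_span_ext => [c x y|c x y|f /degP[b bK ->]].
- by rewrite tg_mul_linearr pure_tensor_linearl linearP.
- by rewrite pure_tensor_linearl linearP mulmxDr scalemxAr.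
rewrite split_action_basis//; move: a aK.
apply: tg_span_ext => [c x y|c x y|c cK].
- by rewrite tg_emb_linear tg_mul_linearl pure_tensor_linearl linearP.
- by rewrite ract_linear mulmxDl -scalemxAl.
rewrite emb_mul// pureZ linearZ /= split_action_basis ?groupM//.
rewrite -scalemxAr mulmxA module_mul// -scalemxAl !scalerA; congr (_ *: _).
by field; exact: psi_neq0 (groupM cK bK).
Qed.

(** Since u_(j n b) is a multiple of u_(j n 1) u_b, the balancing relations bring every tensor of
    degree [n] to the form u_(j n 1) tensor w, and [split_action] recovers w. Injectivity on the
    quotient follows. *)
Lemma balancing_split_action V n t : n \in N -> in_tensor F q n t ->
  balancing F eta q K iota n
    (t - (psi n 1%g)^-1 *: pure (u (j n 1%g)) (split_action V n t)).
Proof.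
move=> nN tn U UP.
have -> : t = \sum_(b in K) pure (u (j n b)) (t (j n b)).
  apply/ffunP => f; rewrite sum_ffunE.
  have [[b bK fE]|Nf] := pselect (exists2 b, b \in K & f = j n b).
    rewrite (bigD1 b)//= big1 => [|c /andP[cK cb]].
      by rewrite !ffunE fE eqxx scale1r addr0.
    rewrite !ffunE fE (_ : _ == _ = false) ?scale0r//.
    by apply: contraNF cb => /eqP /(j_inj nN bK cK) ->.
  rewrite big1 => [|c cK]; last first.
    rewrite !ffunE (_ : _ == _ = false) ?scale0r//.
    by apply/negP => /eqP fE; apply: Nf; exists c.
  apply/eqP; apply: contra_notT Nf => tf0; have [fF fq] := tn _ tf0.
  by apply: degP; rewrite inE fF fq eqxx.
rewrite linear_sum /= -[X in _ - X]/(_ *: _).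
have pure_sum (v : H -> 'cV[k]_(rdim V)) x :
    pure x (\sum_(b in K) v b) = \sum_(b in K) pure x (v b).
  apply/ffunP => f; rewrite sum_ffunE ffunE scaler_sumr.
  by apply: eq_bigr => b _; rewrite ffunE.
rewrite pure_sum scaler_sumr -sumrB; apply: memv_suml => b bK.
rewrite split_action_basis//; set v := t _.
have := UP (u (j n 1%g)) (u b) v (tg_basis_span _ (jdeg nN (group1 K)))
  (tg_basis_span _ bK).
rewrite mul_emb// mul1g (alpha1 bK).1 mul1r pureZ.
have p0 := psi_neq0 nN bK; have p1 := psi_neq0 nN (group1 K).
(* The product of u_(j n 1) with the image of u_b is psi(n,1)/psi(n,b) times u_(j n b); this scaling
   undoes the factor. *)
move=> /(memvZ (psi n b / psi n 1%g)); rewrite scalerBr scalerA.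
rewrite (_ : _ / _ * _ = 1) ?scale1r; last by field; rewrite p0 p1.
suff -> : (psi n 1%g)^-1 *: pure (u (j n 1%g)) (psi n b *: (ract V (u b) *m v)) =
   (psi n b / psi n 1%g) *: pure (u (j n 1%g)) (ract V (u b) *m v) by [].
by apply/ffunP => f; rewrite !ffunE !scalerA; congr (_ *: _); ring.
Qed.

Lemma split_action_tensor_iso V n : is_module K alpha V -> n \in N ->
  tensor_iso F eta q K iota n (split_action V n).
Proof.
move=> Vm nN; have p1 := psi_neq0 nN (group1 K); split.
- by move=> a x v aK xn; exact: split_action_linear.
- move=> w; exists (pure (u (j n 1%g)) ((psi n 1%g)^-1 *: w)).
    move=> f; rewrite !ffunE; case: (f =P j n 1%g) => [-> _|_]; first exact: jF nN (group1 K).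
    by rewrite scale0r eqxx.
  rewrite split_action_basis// (proj1 Vm) mul1mx scalerA divff// scale1r//.
- move=> t tn; split=> [t0|].
    have := balancing_split_action nN tn; rewrite t0.
    have -> : pure (u (j n 1%g)) (0 : 'cV[k]_(rdim V)) = 0.
      by apply/ffunP => f; rewrite !ffunE scaler0.
    by rewrite scaler0 subr0.
  (* [balancing] quantifies over all subspaces containing the relations, and the kernel of
     [split_action] is one of them. *)
  move=> /(_ (lker (split_action V n))); rewrite memv_ker => h.
  apply/eqP/h => x a v xn aK.
  by rewrite memv_ker linearB /= split_action_balanced// subrr.
Qed.

(** On tensors of degree [n], both [c] and [split_action] are onto with the balancing relations as
    kernel, so they differ by an invertible [P]. For general [W] this shows that [n] fixes
    isomorphism classes; for [W = V] it feeds Schur's lemma. *)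
Lemma split_action_universal V W n
    (c : 'Hom({ffun T -> 'cV[k]_(rdim V)}, 'cV[k]_(rdim W))) :
    is_module K alpha V -> n \in N -> tensor_iso F eta q K iota n c ->
  exists P : 'M[k]_(rdim W, rdim V), exists Q : 'M[k]_(rdim V, rdim W),
    [/\ Q *m P = 1%:M, P *m Q = 1%:M,
        {in tg_span k K, forall a, P *m ract V a = ract W a *m P}
      & forall t, in_tensor F q n t -> c t = P *m split_action V n t].
Proof.
move=> Vm nN [clin csurj ck]; have p1 := psi_neq0 nN (group1 K).
have u1n : u (j n 1%g) \in tg_deg k F q n by apply/tg_basis_span/jdeg/group1.
have pin x (v : 'cV[k]_(rdim V)) : x \in tg_deg k F q n -> in_tensor F q n (pure x v).
  move=> xn f; rewrite ffunE => xf0; suff: f \in [set f in F | q f == n]%SET.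
    by rewrite inE => /andP[-> /eqP].
  by apply: contraNT xf0 => /(tg_span_out xn) ->; rewrite scale0r.
have [P PE] : exists P : 'M[k]_(rdim W, rdim V),
    forall v, (psi n 1%g)^-1 *: c (pure (u (j n 1%g)) v) = P *m v.
  apply: linear_mulmx => a v w.
  by rewrite pure_tensor_linearr linearP scalerDr !scalerA mulrC.
have cE t : in_tensor F q n t -> c t = P *m split_action V n t.
  move=> tn; rewrite -PE -linearZ /=; apply/eqP; rewrite -subr_eq0 -linearB.
  apply/eqP/ck; last exact: balancing_split_action.
  move=> f; rewrite !ffunE; case: (f =P j n 1%g) => [-> _|_].
    exact: jF nN (group1 K).
  by rewrite scale0r scaler0 subr0; exact: tn.
have [Q [QP PQ]] : exists Q, Q *m P = 1%:M /\ P *m Q = 1%:M.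
  apply: bijective_mulmx_inv => [v|w]; last first.
    have [t tn <-] := csurj w; exists (split_action V n t); exact/esym/cE.
  rewrite -PE => /eqP; rewrite scaler_eq0 invr_eq0 (negPf p1) /= => /eqP.
  have [_ _ sk] := split_action_tensor_iso Vm nN.
  have vin := pin _ v u1n.
  move=> /(ck _ vin).1 /(sk _ vin).2; rewrite split_action_basis// Vm.1 mul1mx.
  by move/eqP; rewrite scaler_eq0 (negPf p1) => /eqP.
have deg_mul a : a \in tg_span k K -> mult (u (j n 1%g)) (emb a) \in tg_deg k F q n.
  move: a; apply: tg_span_stable => [d x y|b bK].
    by rewrite tg_emb_linear tg_mul_linearr.
  by rewrite mul_emb// mul1g memvZ// tg_basis_span// jdeg.
exists P, Q; split=> // a aK.
(* The two tensor factors of the algebra commute, which is why [P], defined through u_(j n 1),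
   respects the action of k_alpha[K]. *)
have comm1 : mult (u (j n 1%g)) (emb a) = mult (emb a) (u (j n 1%g)).
  move: a aK; apply: tg_span_ext => [d x y|d x y|b bK].
  - by rewrite tg_emb_linear tg_mul_linearr.
  - by rewrite tg_emb_linear tg_mul_linearl.
  - by have [a1b ab1] := alpha1 bK; rewrite mul_emb ?emb_mul// mulg1 mul1g a1b ab1.
suff PaE (v : 'cV[k]_(rdim V)) : P *m ract V a *m v = ract W a *m P *m v.
  apply/matrixP => i l; have := PaE (delta_mx l 0).
  by rewrite -!colE => /colP/(_ i); rewrite !mxE.
rewrite -!mulmxA -!PE -scalemxAr -clin// -comm1; congr (_ *: _).
apply/eqP; rewrite eq_sym -subr_eq0 -linearB; apply/eqP/ck.
  move=> f; rewrite ffunE => f0.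
  have [f1|] := boolP (pure (mult (u (j n 1%g)) (emb a)) v f == 0); last first.
    by apply: pin; exact: deg_mul.
  move: f0; rewrite (eqP f1) add0r ffunE oppr_eq0; exact: pin.
by move=> U; apply.
Qed.

(** The factors alpha and psi cancel against those of [u_mul] and only [lam] survives, so [nu]
    itself satisfies [clifford_pair] with these maps. *)
Lemma split_action_mul V n m x y v : is_module K alpha V -> n \in N -> m \in N ->
    x \in tg_deg k F q n -> y \in tg_deg k F q m ->
  split_action V n (pure x (split_action V m (pure y v)))
    = (lam n m)^-1 *: split_action V (n * m)%g (pure (mult x y) v).
Proof.
move=> Vm nN mN xn; move: y; apply: tg_span_ext => [d y y'|d y y'|f /degP[c cK ->]].
- by rewrite pure_tensor_linearl linearP pure_tensor_linearr linearP.
- rewrite tg_mul_linearr pure_tensor_linearl linearP scalerDr !scalerA.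
  by rewrite [d * _]mulrC.
move: x xn; apply: tg_span_ext => [d x x'|d x x'|g /degP[b bK ->]].
- by rewrite pure_tensor_linearl linearP.
- rewrite tg_mul_linearl pure_tensor_linearl linearP scalerDr !scalerA.
  by rewrite [d * _]mulrC.
rewrite u_mul// pureZ linearZ /= !split_action_basis ?groupM// -scalemxAr mulmxA.
rewrite module_mul// -!scalemxAl !scalerA; congr (_ *: _).
have l0 : lam n m != 0 by have [+ _ _] := tcocycleP nu; apply.
by field; rewrite l0 psi_neq0 ?groupM.
Qed.

Lemma split_irr_act n X : n \in N -> Irr_K X -> irr_act F eta q K iota n X = X.
Proof.
move=> nN [V Vs ->]; apply/seteqP; split=> W.
  move=> [Ws [V' [Vs' VV'] [c cP]]]; split=> //.
  have [Vm' _ _] := Vs'.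
  have [P [Q [QP PQ PE _]]] := split_action_universal Vm' nN cP.
  by apply: module_iso_trans VV' _; exists P, Q.
move=> [Ws VW]; split=> //; exists W => //; exists (split_action W n).
by apply: split_action_tensor_iso => //; case: Ws.
Qed.

Lemma split_irr_stab X : Irr_K X -> irr_stab F eta q K iota X = N.
Proof.
move=> XI; apply/setP => n; rewrite inE split_quotient.
by case nN : (n \in N) => //=; apply/asboolP; exact: split_irr_act.
Qed.

Lemma split_irr_orbit X : Irr_K X -> irr_orbit F eta q K iota X = [set X]%classic.
Proof.
move=> XI; apply/seteqP; split=> Y.
  by move=> [n]; rewrite split_quotient => nN -> /=; exact: split_irr_act.
by move=> ->; exists 1%g; rewrite ?split_quotient ?split_irr_act.
Qed.

Lemma split_irr_orbits :
  irr_orbits F eta q K iota = ((fun X => [set X]) @` Irr_K)%classic.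
Proof.
apply/seteqP; split=> O [X XI OE]; exists X => //; first by rewrite OE split_irr_orbit.
by rewrite split_irr_orbit.
Qed.

Lemma split_clifford_pair X : Irr_K X ->
  clifford_pair F eta q K iota X nu.
Proof.
move=> XI; split; first by rewrite split_irr_stab.
have [V Vs XE] := XI; exists V.
  by rewrite XE; split=> //; exact: module_iso_refl.
have [Vm _ _] := Vs; exists (split_action V); rewrite split_irr_stab//.
  by move=> n nN; exact: split_action_tensor_iso.
move=> n m nN mN x y v xn ym.
by rewrite split_action_mul.
Qed.

(* By Schur's lemma another choice of the isomorphisms changes each of them by *)
(* a scalar, hence the cocycle by a coboundary.                                *)
Lemma split_clifford_pair_unique X p : Irr_K X ->
  clifford_pair F eta q K iota X p -> class_of p = class_of nu.
Proof.
move=> XI []; rewrite split_irr_stab// => pN [V]; have [V0 Vs0 ->] := XI.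
move=> [Vs _] [c cP cM]; have [Vm Vgt0 _] := Vs.
have [P PP] : exists P : S -> k, {in N, forall n, P n != 0 /\
    forall t, in_tensor F q n t -> c n t = P n *: split_action V n t}.
  suff /choice[P PP] : forall n, exists a : k, n \in N -> a != 0 /\
    forall t, in_tensor F q n t -> c n t = a *: split_action V n t by exists P.
  move=> n; have [nN|] := boolP (n \in N); last by exists 0.
  have [A [B [BA AB AE cE]]] := split_action_universal Vm nN (cP n nN).
  have [a aE] := schur Vs AE; exists a => _; split; last first.
    by move=> t /cE; rewrite aE mul_scalar_mx.
  apply: contraTneq Vgt0 => a0; rewrite -eqn0Ngt.
  move: BA; rewrite aE a0 mul_mx_scalar scale0r => /matrixP; case: (rdim V) => // d.
  by move=> /(_ 0 0); rewrite !mxE eqxx => /esym/eqP; rewrite oner_eq0.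
have [v v0] : exists v : 'cV[k]_(rdim V), v != 0.
  exists (const_mx 1); apply: contraTneq Vgt0 => /matrixP; case: (rdim V) => // d.
  by move=> /(_ 0 0); rewrite !mxE => /eqP; rewrite oner_eq0.
have lE n m : n \in N -> m \in N ->
    tcocycle p n m = lam n m * ((P n)^-1 * (P m)^-1 / (P (n * m)%g)^-1).
  move=> nN mN; have nmN := groupM nN mN.
  have [[Pn0 Pn] [Pm0 Pm]] := (PP n nN, PP m mN); have [Pnm0 Pnm] := PP _ nmN.
  have l0 : lam n m != 0 by have [+ _ _] := tcocycleP nu; apply.
  have t0 : tcocycle p n m != 0.
    by have [+ _ _] := tcocycleP p; apply; rewrite pN.
  have udeg n' : n' \in N -> u (j n' 1%g) \in tg_deg k F q n'.
    by move=> nN'; apply/tg_basis_span/jdeg/group1.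
  have pin n' (w : 'cV[k]_(rdim V)) : n' \in N -> in_tensor F q n' (pure (u (j n' 1%g)) w).
    move=> nN' f; rewrite !ffunE; case: (f =P j n' 1%g) => [-> _|_].
      exact: jF nN' (group1 K).
    by rewrite scale0r eqxx.
  (* Evaluating at u_(j n 1), u_(j m 1) and a nonzero [v] turns the identity for [c] into one
     between scalars, which determines [tcocycle p n m]. *)
  have := cM n m nN mN _ _ v (udeg n nN) (udeg m mN).
  rewrite u_mul// pureZ linearZ /= mulg1 Pn; last exact: pin.
  rewrite Pm; last exact: pin.
  rewrite Pnm; last exact: pin.
  rewrite !split_action_basis// (proj1 Vm) !mul1mx !scalerA.
  rewrite (alpha1 (group1 K)).1 => /eqP; rewrite -subr_eq0 -scalerBl scaler_eq0.
  rewrite (negPf v0) orbF subr_eq0 => /eqP E.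
  have [p1 p2] := (psi_neq0 nN (group1 K), psi_neq0 mN (group1 K)).
  have p3 := psi_neq0 nmN (group1 K).
  have {}E : P n * P m = (tcocycle p n m)^-1 * lam n m * P (n * m)%g.
    apply: (mulfI (mulf_neq0 p1 p2)); move: E.
    rewrite (_ : _ * _ = psi n 1%g * psi m 1%g * (P n * P m)); last by ring.
    by move=> ->; field; rewrite t0 p3.
  rewrite invrK -invfM E; field.
  by rewrite t0 l0 Pnm0.
apply/esym/class_ofP; exists 1%g; first by rewrite pN conjsg1.
exists (fun n => (P n)^-1); rewrite pN.
  by move=> n nN; rewrite invr_neq0// (PP n nN).1.
by move=> n m nN mN; rewrite invg1 !conjg1 lE.
Qed.

(** Orbits are singletons, so [xget] returns their only element, and each contributes the class of
    [nu]; what remains is the number of simple modules. *)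
Lemma split_clifford_sum p0 :
  \sum_(O \in irr_orbits F eta q K iota)
     basis_elt (class_of (xget p0 (clifford_pair F eta q K iota (xget set0 O))))
  = basis_elt (class_of nu) *~ irr_count K alpha.
Proof.
rewrite split_irr_orbits fsbig_image; last first.
  by move=> X Y _ _ XY; have : [set X]%classic X by []; rewrite XY.
rewrite -fsumr_const; apply: eq_fsbigr => X; rewrite inE => XI.
have -> : xget set0 [set X]%classic = X by apply: xget_unique.
have -> // : class_of (xget p0 (clifford_pair F eta q K iota X)) = class_of nu.
apply: (split_clifford_pair_unique XI).
exact: (xgetI _ (split_clifford_pair XI)).
Qed.

End SplitClifford.

(** * Products of twisted pairs *)

Section ConjugationOfPairs.

Variables (k : fieldType) (T : finGroupType).
Implicit Types p q r : twisted_pair k T.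

(** [twisted_conj] with the conjugating element visible: [pairing_at_conj] needs it to tell how [g]
    moves. *)
Definition conj_by p q (t : T) : Prop :=
  tgroup q = (tgroup p :^ t)%g :> {set T} /\
  cohomologous (tgroup q)
    (fun x y => tcocycle p (x ^ t^-1)%g (y ^ t^-1)%g) (tcocycle q).

Lemma twisted_conjP p q : twisted_conj p q <-> exists t, conj_by p q t.
Proof. by split=> [[t pq1 pq2]|[t [pq1 pq2]]]; exists t. Qed.

Lemma cocycle_neq0 p x y : x \in tgroup p -> y \in tgroup p -> tcocycle p x y != 0.
Proof. by have [+ _ _] := tcocycleP p; apply. Qed.

Lemma cocycle1l p x : x \in tgroup p -> tcocycle p 1%g x = 1.
Proof. by have [_ + _] := tcocycleP p => h /h[]. Qed.

Lemma cocycle1r p x : x \in tgroup p -> tcocycle p x 1%g = 1.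
Proof. by have [_ + _] := tcocycleP p => h /h[]. Qed.

Lemma cocycleM p x y z : x \in tgroup p -> y \in tgroup p -> z \in tgroup p ->
  tcocycle p x y * tcocycle p (x * y)%g z = tcocycle p y z * tcocycle p x (y * z)%g.
Proof. by have [_ _ +] := tcocycleP p; apply. Qed.

(* In the twisted group algebra, u_x u_t = f x u_t u_(x ^ t), so conjugation by *)
(* u_t identifies the two cocycles.                                            *)
Lemma conj_by_inner p t : t \in tgroup p -> conj_by p p t.
Proof.
move=> tp; split; first by rewrite conjGid.
pose mu := tcocycle p.
pose f x := mu x t / mu t (x ^ t)%g.
have memV x : x \in tgroup p -> (x ^ t^-1)%g \in tgroup p by rewrite groupJr ?groupV.
exists (fun x => (f (x ^ t^-1)%g)^-1) => [x /memV xp|x' y' /memV xp /memV yp].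
  by rewrite invr_neq0// mulf_neq0 ?invr_neq0 ?cocycle_neq0// groupJ.
rewrite conjMg -{1}(conjgKV t x') -{1}(conjgKV t y').
move: (x' ^ t^-1)%g (y' ^ t^-1)%g xp yp => x y xp yp {x' y'}.
have [xt yt] := (groupJ xp tp, groupJ yp tp).
have xyp := groupM xp yp; have xyt := groupM xt yt.
rewrite -/mu invrK /f conjMg.
have n := cocycle_neq0 (p := p).
have E1 : mu x y * mu (x * y)%g t = mu y t * mu x (y * t)%g by exact: cocycleM.
have E2 : mu x t * mu (x * t)%g (y ^ t)%g = mu t (y ^ t)%g * mu x (y * t)%g.
  by rewrite [(y * t)%g]conjgC; exact: cocycleM.
have E3 : mu t (x ^ t)%g * mu (x * t)%g (y ^ t)%g
    = mu (x ^ t)%g (y ^ t)%g * mu t ((x ^ t) * (y ^ t))%g.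
  by rewrite [(x * t)%g]conjgC; exact: cocycleM.
have a1 : mu x t != 0 by exact: n.
have a2 : mu y t != 0 by exact: n.
have a3 : mu t (x ^ t)%g != 0 by exact: n.
have a4 : mu t (y ^ t)%g != 0 by exact: n.
have a5 : mu (x * y)%g t != 0 by exact: n.
have a6 : mu t (x ^ t * y ^ t)%g != 0 by exact: n.
have a7 : mu x (y * t)%g != 0 by apply: n => //; exact: groupM.
have a8 : mu (x * t)%g (y ^ t)%g != 0 by apply: n => //; exact: groupM.
have -> : mu (x ^ t)%g (y ^ t)%g =
    mu t (x ^ t)%g * mu (x * t)%g (y ^ t)%g / mu t (x ^ t * y ^ t)%g.
  by rewrite E3 mulfK.
have -> : mu x y = mu y t * mu x (y * t)%g / mu (x * y)%g t by rewrite -E1 mulfK.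
have -> : mu (x * t)%g (y ^ t)%g = mu t (y ^ t)%g * mu x (y * t)%g / mu x t.
  by rewrite -E2 mulrC mulKf.
by field; rewrite a1 a2 a3 a4 a5 a6.
Qed.

Fact conj_pair_cocycle p t :
  is_cocycle (tgroup p :^ t)%g (fun x y => tcocycle p (x ^ t^-1)%g (y ^ t^-1)%g).
Proof.
split.
- by move=> x y; rewrite !mem_conjg; exact: cocycle_neq0.
- by move=> x; rewrite !mem_conjg conj1g => xp; rewrite cocycle1l ?cocycle1r.
- by move=> x y z; rewrite !mem_conjg => xp yp zp; rewrite !conjMg cocycleM.
Qed.

Definition conj_pair p t : twisted_pair k T :=
  mk_twisted_pair (L := (tgroup p :^ t)%G) (conj_pair_cocycle p t).

Lemma mk_tcocycle (L : {group T}) (mu : T -> T -> k) (hmu : is_cocycle L mu) x y :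
  tcocycle (mk_twisted_pair hmu) x y = mu x y.
Proof. by rewrite /tcocycle ffunE. Qed.

Lemma conj_pairP p t : conj_by p (conj_pair p t) t.
Proof.
split=> //; exists (fun=> 1) => [x _|x y _ _]; first exact: oner_neq0.
by rewrite mk_tcocycle mulr1 divr1 mulr1.
Qed.

(** The cochain is pulled back to the group of [p]. Both cocycles being normalized, their comparison
    at (1,1) forces [f 1%g = 1], which transport of modules requires. *)
Lemma conj_byP p q t : conj_by p q t ->
  tgroup q = (tgroup p :^ t)%g :> {set T} /\
  exists f : T -> k, [/\ {in tgroup p, forall x, f x != 0}, f 1%g = 1
    & {in tgroup p &, forall x y, tcocycle q (x ^ t)%g (y ^ t)%g
        = tcocycle p x y * (f x * f y / f (x * y)%g)}].
Proof.
move=> [Lq [f f0 fE]]; split=> //; exists (fun x => f (x ^ t)%g).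
have memq x : x \in tgroup p -> (x ^ t)%g \in tgroup q by rewrite Lq memJ_conjg.
split=> [x /memq /f0//||x y xp yp].
  have q1 := group1 (tgroup q); have := fE _ _ q1 q1.
  rewrite !conj1g mulg1 !cocycle1l// mul1r mulfK ?f0//.
by rewrite fE ?memq// !conjgK conjMg.
Qed.

End ConjugationOfPairs.

Section ProductPairs.

Variables (k : fieldType) (G H : finGroupType).
Implicit Types (a : twisted_pair k G) (b : twisted_pair k H).

Lemma mem_setX (A : {set G}) (B : {set H}) x :
  (x \in finset.setX A B) = (x.1 \in A) && (x.2 \in B).
Proof. by case: x => x y; rewrite finset.in_setX. Qed.

Lemma setX_group_set (A : {group G}) (B : {group H}) : group_set (finset.setX A B).
Proof.
apply/group_setP; split=> [|x y]; rewrite !mem_setX; first by rewrite !group1.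
by move=> /andP[x1 x2] /andP[y1 y2]; rewrite !groupM.
Qed.

Definition prod_group (A : {group G}) (B : {group H}) : {group G * H} :=
  Group (setX_group_set A B).

Fact prod_cocycle a b : is_cocycle (prod_group (tgroup a) (tgroup b))
  (fun x y => tcocycle a x.1 y.1 * tcocycle b x.2 y.2).
Proof.
split.
- move=> x y; rewrite !mem_setX => /andP[x1 x2] /andP[y1 y2].
  by rewrite mulf_neq0// cocycle_neq0.
- move=> x; rewrite !mem_setX => /andP[x1 x2].
  by rewrite !cocycle1l// !cocycle1r// mulr1.
- move=> x y z; rewrite !mem_setX => /andP[x1 x2] /andP[y1 y2] /andP[z1 z2].
  by rewrite mulrACA /= !cocycleM// mulrACA.
Qed.

Definition prod_pair a b : twisted_pair k (G * H)%type :=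
  mk_twisted_pair (prod_cocycle a b).

Lemma conjg_pair (x y : G * H) : (x ^ y)%g = ((x.1 ^ y.1)%g, (x.2 ^ y.2)%g).
Proof. by []. Qed.

Lemma prod_pair_conj_by a a' b b' t u : conj_by a a' t -> conj_by b b' u ->
  conj_by (prod_pair a b) (prod_pair a' b') (t, u).
Proof.
move=> [Aa' [f f0 fE]] [Bb' [g g0 gE]]; split.
  by apply/setP => x; rewrite mem_conjg !mem_setX Aa' Bb' !mem_conjg.
exists (fun x => f x.1 * g x.2) => [x|x y]; rewrite !mem_setX /=.
  by move=> /andP[x1 x2]; rewrite mulf_neq0 ?f0 ?g0.
move=> /andP[x1 x2] /andP[y1 y2]; rewrite !mk_tcocycle fE// gE//.
have h1 := f0 _ (groupM x1 y1); have h2 := g0 _ (groupM x2 y2).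
by rewrite !conjg_pair /=; field; rewrite h1 h2.
Qed.

Lemma twisted_conj_prod a a' b b' : twisted_conj a a' -> twisted_conj b b' ->
  twisted_conj (prod_pair a b) (prod_pair a' b').
Proof.
move=> /twisted_conjP[t aa'] /twisted_conjP[u bb']; apply/twisted_conjP.
by exists (t, u); exact: prod_pair_conj_by.
Qed.

(** Restriction to A x 1 and to 1 x B recovers each factor with its class. This is what makes the
    E_{a,b} distinct. *)
Lemma prod_pair_inj a a' b b' : twisted_conj (prod_pair a b) (prod_pair a' b') ->
  twisted_conj a a' /\ twisted_conj b b'.
Proof.
move=> /twisted_conjP[[t u] [/setP LE [f f0 fE]]]; split; apply/twisted_conjP.
  exists t; split.
    apply/setP => x; have := LE (x, 1%g).
    by rewrite mem_conjg !mem_setX conjg_pair /= mem_conjg conj1g !group1 !andbT.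
  exists (fun x => f (x, 1%g)) => [x xa|x y xa ya].
    by apply: f0; rewrite mem_setX /= xa group1.
  have := fE (x, 1%g) (y, 1%g).
  rewrite !mem_setX /= !xa !ya !group1 !mk_tcocycle !conjg_pair /= conj1g !cocycle1l// !mulr1.
  by rewrite -[((x, 1) * (y, 1))%g]/((x * y)%g, (1 * 1)%g) mulg1; exact.
exists u; split.
  apply/setP => x; have := LE (1%g, x).
  by rewrite mem_conjg !mem_setX conjg_pair /= mem_conjg conj1g !group1.
exists (fun x => f (1%g, x)) => [x xa|x y xa ya].
  by apply: f0; rewrite mem_setX /= xa group1.
have := fE (1%g, x) (1%g, y).
rewrite !mem_setX /= !xa !ya !group1 !mk_tcocycle !conjg_pair /= conj1g !cocycle1l// !mul1r.
by rewrite -[((1, x) * (1, y))%g]/((1 * 1)%g, (x * y)%g) mulg1; exact.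
Qed.

(** Applied to the representative chosen by [class_repr]: a conjugate of a product group is still
    literally a product, whereas the cocycle is one only up to the coboundary of [f], later absorbed
    into [psi]. *)
Lemma conj_prod_pair a b p : twisted_conj (prod_pair a b) p ->
  exists a' b' (f : G * H -> k),
  [/\ twisted_conj a a', twisted_conj b b',
      tgroup p = finset.setX (tgroup a') (tgroup b') :> {set _},
      {in tgroup p, forall x, f x != 0} /\ f 1%g = 1
    & {in tgroup p &, forall x y, tcocycle p x y
        = tcocycle a' x.1 y.1 * tcocycle b' x.2 y.2 * (f x * f y / f (x * y)%g)}].
Proof.
move=> /twisted_conjP[[t u] [LE [f f0 fE]]].
exists (conj_pair a t), (conj_pair b u), f; split.
- by apply/twisted_conjP; exists t; exact: conj_pairP.
- by apply/twisted_conjP; exists u; exact: conj_pairP.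
- by rewrite LE; apply/setP => x; rewrite mem_conjg !mem_setX !mem_conjg.
- split=> //; have p1 := group1 (tgroup p); have := fE _ _ p1 p1.
  rewrite !conj1g mulg1 !cocycle1l// mul1r mulfK ?f0//.
- by move=> x y xp yp; rewrite fE// !mk_tcocycle.
Qed.

End ProductPairs.

(** * Multiplicities and their independence of representatives *)

Section Pairing.

Variables (k : fieldType) (H : finGroupType).
Implicit Types b c : twisted_pair k H.

(* The size of Irr(A_g) in a composition whose middle factors are b and c.    *)
Definition pairing_at b c (g : H) : int :=
  irr_count (tgroup b :&: tgroup c :^ g^-1)%g
    (fun x y => tcocycle b x y * tcocycle c (x ^ g)%g (y ^ g)%g).

Definition pairing b c : int :=
  \sum_(D in [set tgroup b :* g * tgroup c | g : H]%g%SET)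
    pairing_at b c (fingroup.repr D).

(** Conjugation by [y] carries one intersection onto the other, and changes the cocycle by the
    coboundary of [f x * h (x ^ g)], so [irr_count_transport] applies. *)
Lemma pairing_at_conj b c b' c' y z g : conj_by b b' y -> conj_by c c' z ->
  pairing_at b' c' (y^-1 * g * z)%g = pairing_at b c g.
Proof.
move=> /conj_byP[Bb' [f [f0 f1 fE]]] /conj_byP[Cc' [h [h0 h1 hE]]].
set g' := (y^-1 * g * z)%g.
have memb x : (x ^ y \in tgroup b')%g = (x \in tgroup b) by rewrite Bb' memJ_conjg.
have memc x : (x ^ z \in tgroup c')%g = (x \in tgroup c) by rewrite Cc' memJ_conjg.
have yg' x : ((x ^ y) ^ g' = (x ^ g) ^ z)%g by rewrite -!conjgM /g' !mulgA mulgV mul1g.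
apply/esym/(irr_count_transport (K := (tgroup b :&: tgroup c :^ g^-1)%G)
  (K' := (tgroup b' :&: tgroup c' :^ g'^-1)%G)
  (th := conjg^~ y) (th' := conjg^~ y^-1%g) (om := fun x => f x * h (x ^ g)%g)).
- by move=> x; rewrite !inE !mem_conjgV memb yg' memc.
- by move=> x; rewrite -{1}(conjgKV y x) !inE !mem_conjgV memb yg' memc.
- by move=> x _; rewrite conjgK.
- by move=> x _; rewrite conjgKV.
- by move=> x x' _ _; rewrite conjMg.
- by move=> x; rewrite !inE mem_conjgV => /andP[xb xc]; rewrite mulf_neq0 ?f0 ?h0.
- by rewrite conj1g f1 h1 mulr1.
- move=> x x'; rewrite !inE !mem_conjgV => /andP[xb xc] /andP[xb' xc'].
  rewrite !yg' fE// hE// conjMg.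
  have n1 := f0 _ (groupM xb xb'); have n2 := h0 _ (groupM xc xc').
  by field; rewrite n1 n2.
Qed.

Lemma mem_double_coset (B C : {group H}) g :
  (fingroup.repr (B :* g * C) \in B :* g * C)%g.
Proof.
apply: (mem_repr g); apply/mulsgP; exists g 1%g; rewrite ?group1 ?mulg1//.
exact: rcoset_refl.
Qed.

(** Write r = y g z with y and z in the two groups: by [conj_by_inner], conjugation by y^-1 and z
    fixes both pairs, so [pairing_at_conj] relates [r] to [g]. *)
Lemma pairing_at_coset b c g r : r \in (tgroup b :* g * tgroup c)%g ->
  pairing_at b c r = pairing_at b c g.
Proof.
move=> /mulsgP[_ z /rcosetP[y yb ->] zc ->].
rewrite -{1}(invgK y); apply: pairing_at_conj; last exact: conj_by_inner.
by apply: conj_by_inner; rewrite groupV.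
Qed.

Lemma pairing_conj b c b' c' : twisted_conj b b' -> twisted_conj c c' ->
  pairing b' c' = pairing b c.
Proof.
move=> /twisted_conjP[y bb'] /twisted_conjP[z cc'].
(* This translation matches the double cosets of the two pairs of groups, sending that of [g] to
   that of [y^-1 * g * z]. *)
pose h (D : {set H}) := (y^-1 *: D :* z)%g.
have hE g : h (tgroup b :* g * tgroup c)%g = (tgroup b' :* (y^-1 * g * z) * tgroup c')%g.
  have [-> _] := bb'; have [-> _] := cc'.
  have gE : [set g]%SET = ([set y] * [set y^-1 * g * z] * [set z^-1])%g.
    by rewrite !mulg_set1 !mulgA mulgV mul1g mulgK.
  by rewrite /h !conjsgE [in LHS]gE !mulgA.
have h_inj : injective h.
  have setV (x : H) : ([set x] * [set x^-1] = 1)%g by rewrite mulg_set1 mulgV.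
  apply: (can_inj (g := fun D => ([set y] * D * [set z^-1])%g)) => D.
  by rewrite /h -!mulgA setV mulg1 mulgA setV mul1g.
rewrite /pairing.
have -> : [set tgroup b' :* g * tgroup c' | g : H]%g%SET
    = [set h D | D in [set tgroup b :* g * tgroup c | g : H]%g]%SET.
  apply/setP => D; apply/imsetP/imsetP => [[g _ ->]|[_ /imsetP[g _ ->] ->]].
    exists (tgroup b :* (y * g * z^-1) * tgroup c)%g; first exact: imset_f.
    by rewrite hE !mulgA mulVg mul1g mulgKV.
  by exists (y^-1 * g * z)%g.
rewrite big_imset => [|D D' _ _ /h_inj//]; apply: eq_bigr => _ /imsetP[g _ ->].
rewrite hE (pairing_at_coset (mem_double_coset _ _ _)) (pairing_at_conj g bb' cc').
by rewrite (pairing_at_coset (mem_double_coset _ _ _)).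
Qed.

End Pairing.

Section CompositionOfProducts.

Variables (k : closedFieldType) (G H K : finGroupType).

(** The elements of F_g are the ((x,y),(y,z)) with (x,z) in A x D and y in the intersection of B
    with a conjugate of C; this is the splitting [j] fed to [split_clifford_sum]. *)
Lemma clifford_sum_prod (p : twisted_pair k (G * H)%type) (q : twisted_pair k (H * K)%type)
    (a : twisted_pair k G) (b c : twisted_pair k H) (d : twisted_pair k K)
    (f : G * H -> k) (h : H * K -> k) g :
    tgroup p = finset.setX (tgroup a) (tgroup b) :> {set _} ->
    {in tgroup p, forall x, f x != 0} /\ f 1%g = 1 ->
    {in tgroup p &, forall x y, tcocycle p x y
        = tcocycle a x.1 y.1 * tcocycle b x.2 y.2 * (f x * f y / f (x * y)%g)} ->
    tgroup q = finset.setX (tgroup c) (tgroup d) :> {set _} ->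
    {in tgroup q, forall x, h x != 0} /\ h 1%g = 1 ->
    {in tgroup q &, forall x y, tcocycle q x y
        = tcocycle c x.1 y.1 * tcocycle d x.2 y.2 * (h x * h y / h (x * y)%g)} ->
  clifford_sum p q g = basis_elt (class_of (prod_pair a d)) *~ pairing_at b c g.
Proof.
move=> pE [f0 f1] fE qE [h0 h1] hE.
(* On F_g, the cocycle is the product cocycle times the coboundary of [Phi]. *)
pose Phi (x : (G * H) * (H * K)) := f x.1 * h (x.2 ^ (g, 1))%g.
pose j (n : G * K) (y : H) : (G * H) * (H * K) := ((n.1, y), (y, n.2)).
(* Division by the value at n = 1 gives [psi 1%g y = 1]; the part divided out is a coboundary on
   [KK], which belongs to alpha_g. *)
pose psi n y := Phi (j n y) / Phi (j 1%g y).
pose KK := (tgroup b :&: tgroup c :^ g^-1)%G.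
have memK y : (y \in KK) = (y \in tgroup b) && (y ^ g \in tgroup c)%g.
  by rewrite inE mem_conjgV.
have memp x : (x \in tgroup p) = (x.1 \in tgroup a) && (x.2 \in tgroup b).
  by rewrite pE mem_setX.
have memq x : (x \in tgroup q) = (x.1 \in tgroup c) && (x.2 \in tgroup d).
  by rewrite qE mem_setX.
have memN n : (n \in tgroup (prod_pair a d)) = (n.1 \in tgroup a) && (n.2 \in tgroup d).
  by rewrite mem_setX.
have memM x : (x \in conjM q g) = (x.1 ^ g \in tgroup c)%g && (x.2 \in tgroup d).
  by rewrite mem_conjgV memq conjg_pair /= conjg1.
have kerE : star_ker p q g = KK.
  apply/setP => y; rewrite inE memp memM memK /=.
  by rewrite !group1 andbT.
have jp n y : n \in tgroup (prod_pair a d) -> y \in KK -> (n.1, y) \in tgroup p.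
  by rewrite memN memK memp /= => /andP[-> _] /andP[-> _].
have jq n y : n \in tgroup (prod_pair a d) -> y \in KK ->
    ((y, n.2) ^ (g, 1))%g \in tgroup q.
  by rewrite memN memK memq conjg_pair /= conjg1 => /andP[_ ->] /andP[_ ->].
have Phi0 n y : n \in tgroup (prod_pair a d) -> y \in KK -> Phi (j n y) != 0.
  by move=> nN yK; rewrite mulf_neq0 ?f0 ?h0 ?jp ?jq.
have jM n m y z : (j n y * j m z = j (n * m) (y * z))%g by [].
have starE n m y z : n \in tgroup (prod_pair a d) -> m \in tgroup (prod_pair a d) ->
    y \in KK -> z \in KK ->
  star_cocycle p q g (j n y) (j m z)
    = tcocycle (prod_pair a d) n m * (tcocycle b y z * tcocycle c (y ^ g)%g (z ^ g)%g)
      * (Phi (j n y) * Phi (j m z) / Phi (j (n * m)%g (y * z)%g)).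
  move=> nN mN yK zK; rewrite /star_cocycle /conj_nu fE ?jp// hE ?jq//.
  rewrite mk_tcocycle -jM /Phi -conjMg !conjg_pair /= !conjg1.
  have n1 : f ((n.1, y) * (m.1, z))%g != 0 by rewrite f0// groupM ?jp.
  have n2 : h ((y * z) ^ g, n.2 * m.2)%g != 0.
    have := h0 _ (groupM (jq _ _ nN yK) (jq _ _ mN zK)).
    by rewrite -conjMg conjg_pair /= conjg1.
  by field; rewrite n1 n2.
have N1 := group1 (tgroup (prod_pair a d)); have KK1 := group1 KK.
have psi0 n y : n \in tgroup (prod_pair a d) -> y \in KK -> psi n y != 0.
  by move=> nN yK; rewrite mulf_neq0 ?invr_neq0 ?Phi0.
have iotaE y z : y \in KK -> z \in KK ->
    star_cocycle p q g (star_ker_emb G K y) (star_ker_emb G K z)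
  = tcocycle b y z * tcocycle c (y ^ g)%g (z ^ g)%g
      * (Phi (j 1%g y) * Phi (j 1%g z) / Phi (j 1%g (y * z)%g)).
  move=> yK zK; have := starE 1%g 1%g y z N1 N1 yK zK.
  by rewrite cocycle1l// mul1r mulg1; exact.
rewrite /clifford_sum /clifford_class kerE.
rewrite (@split_clifford_sum k _ _ H (star_group p q g) (star_cocycle p q g)
  (@star_map G H K) KK (@star_ker_emb G H K) (prod_pair a d) j psi).
- congr (_ *~ _); apply/esym.
  (* The cocycle alpha_g equals that of [pairing_at] only up to the coboundary of [Phi (j 1%g y)],
     so the identity map is transported with these scalars. *)
  apply: (irr_count_transport (K := KK) (K' := KK) (th := id) (th' := id)
    (om := fun y => Phi (j 1%g y))) => //.
  + by move=> y yK; exact: Phi0.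
  + by rewrite /Phi /= conj1g f1 h1 mulr1.
- move=> n y nN yK; split=> //; last by case: n {nN}.
  rewrite inE jp//= eqxx andbT memM /=.
  by move: nN yK; rewrite memN memK => /andP[_ ->] /andP[_ ->].
- by move=> n nN y z yK zK [].
- move=> [[x1 x2] [x3 x4]]; rewrite inE memp memM /= => /and3P[/andP[xa xb] /andP[xc xd] /eqP x23].
  rewrite -x23 in xc *; rewrite memN /= xa xd; split=> //.
  by exists x2; rewrite ?memK ?xb.
- by [].
- by [].
- exact: psi0.
- by move=> y yK; rewrite /psi divff// Phi0.
- move=> y yK; have : y \in KK by []; rewrite memK => /andP[yb yc].
  have Phi1 : Phi (j 1%g 1%g) = 1 by rewrite /Phi /= conj1g f1 h1 mulr1.
  rewrite !iotaE// conj1g !cocycle1l// !cocycle1r// mul1g mulg1 Phi1 !mul1r mulr1.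
  by rewrite divff ?Phi0.
- move=> n m nN mN y z yK zK; rewrite starE// iotaE//.
  have p1 := Phi0 _ _ N1 yK; have p2 := Phi0 _ _ N1 zK.
  have p3 := Phi0 _ _ N1 (groupM yK zK).
  have p4 := Phi0 _ _ (groupM nN mN) (groupM yK zK).
  by rewrite /psi; field; rewrite p1 p2 p3 p4.
Qed.

Lemma comp_basis_prod (a : twisted_pair k G) (b c : twisted_pair k H)
    (d : twisted_pair k K) :
  comp_basis (class_of (prod_pair a b)) (class_of (prod_pair c d))
    = basis_elt (class_of (prod_pair a d)) *~ pairing b c.
Proof.
rewrite /comp_basis; set p := class_repr _; set q := class_repr (class_of (prod_pair c d)).
have abp : twisted_conj (prod_pair a b) p by apply/class_ofP; rewrite class_reprK.
have cdq : twisted_conj (prod_pair c d) q by apply/class_ofP; rewrite class_reprK.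
have [a' [b' [f [aa' bb' pE f0 fE]]]] := conj_prod_pair abp.
have [c' [d' [h [cc' dd' qE h0 hE]]]] := conj_prod_pair cdq.
have -> : class_of (prod_pair a d) = class_of (prod_pair a' d').
  exact/class_ofP/twisted_conj_prod.
rewrite -(pairing_conj bb' cc') /pairing mulrz_sumr.
have -> : double_cosets p q = [set tgroup b' :* g * tgroup c' | g : H]%g%SET.
  rewrite /double_cosets.
  have -> : [set x.2 | x in tgroup p]%SET = tgroup b'.
    apply/setP => y; apply/imsetP/idP => [[x + ->]|yb].
      by rewrite pE mem_setX => /andP[].
    by exists (1%g, y); rewrite // pE mem_setX group1.
  have -> // : [set x.1 | x in tgroup q]%SET = tgroup c'.
  apply/setP => y; apply/imsetP/idP => [[x + ->]|yb].
    by rewrite qE mem_setX => /andP[].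
  by exists (y, 1%g); rewrite // qE mem_setX /= group1 andbT.
by apply: eq_bigr => D _; exact: (clifford_sum_prod _ pE f0 fE qE h0 hE).
Qed.

End CompositionOfProducts.

(** * The unit of the composition *)

(** There is one double coset and one simple module; hence composing over the trivial group gives a
    single basis element, as for E_{a,b}. *)
Lemma pairing_trivial (k : fieldType) (H : finGroupType) (b c : twisted_pair k H) :
  [set: H]%SET = 1%g -> pairing b c = 1.
Proof.
move=> H1; have all1 (x : H) : x = 1%g by apply/set1gP; rewrite -H1 inE.
have set1P (A : {set H}) : 1%g \in A -> A = 1%g.
  by move=> A1; apply/setP => x; rewrite (all1 x) A1 set11.
rewrite /pairing.
have -> : [set tgroup b :* g * tgroup c | g : H]%g%SET = [set 1%g]%SET.
  have cosetE g : (tgroup b :* g * tgroup c = 1)%g.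
    by apply: set1P; rewrite -(all1 (fingroup.repr (tgroup b :* g * tgroup c)%g)) mem_double_coset.
  apply/setP => D; rewrite finset.in_set1.
  by apply/imsetP/eqP => [[g _ ->]|->]; last exists 1%g.
rewrite big_set1 /pairing_at; apply: irr_count_trivial.
  by apply: set1P; rewrite !group1.
by rewrite conj1g !cocycle1l// mulr1.
Qed.

Section Unit.

Variables (k : closedFieldType) (G K : finGroupType).

(** A conjugate of the diagonal is the graph of conjugation by some [w], with a coboundary as
    cocycle. Then K_g is trivial and [star_map] is injective on F_g. *)
Lemma clifford_sum_unit (p : twisted_pair k (G * G)%type)
    (q : twisted_pair k (G * K)%type) (w : G) (f : G -> k) g :
    (forall x, (x \in tgroup p) = (x.2 == x.1 ^ w)%g) ->
    (forall u, f u != 0) -> f 1%g = 1 ->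
    (forall u v, tcocycle p (u, (u ^ w)%g) (v, (v ^ w)%g) = f u * f v / f (u * v)%g) ->
  clifford_sum p q g = basis_elt (class_of q).
Proof.
move=> memp f0 f1 fE.
(* For ((x, x^w), (x^w, z)) in F_g the condition is that (x^(w g), z) lies in the group of [q], so
   N_g is this conjugate. *)
pose n0 := conj_pair q ((w * g)^-1, 1)%g.
pose j (n : G * K) (y : G) : (G * G) * (G * K) := ((n.1, n.1 ^ w), (n.1 ^ w, n.2))%g.
pose psi (n : G * K) (y : G) := f n.1.
have memN n : (n \in tgroup n0) = ((n.1 ^ (w * g), n.2) \in tgroup q)%g.
  by rewrite mem_conjg conjg_pair /= invgK invg1 conjg1.
have memM x : (x \in conjM q g) = ((x.1 ^ g, x.2) \in tgroup q)%g.
  by rewrite mem_conjgV conjg_pair /= conjg1.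
have kerE : star_ker p q g = 1%G.
  apply/setP => y; rewrite inE memp memM /= conj1g.
  apply/andP/set1gP => [[/eqP//]|->].
  by rewrite conj1g eqxx; split=> //; exact: group1.
have -> : class_of q = class_of n0.
  by apply/class_ofP/twisted_conjP; exists ((w * g)^-1, 1)%g; exact: conj_pairP.
have in1 (y : G) : y \in 1%G -> y = 1%g by move/set1gP.
have alpha1 : star_cocycle p q g (star_ker_emb G K 1%g) (star_ker_emb G K 1%g) = 1.
  have := fE 1%g 1%g; rewrite conj1g mulg1 f1 divr1 mulr1 => E.
  by rewrite /star_cocycle /conj_nu !conj1g [tcocycle p _ _]E cocycle1l// mulr1.
rewrite /clifford_sum /clifford_class kerE.
rewrite (@split_clifford_sum k _ _ G (star_group p q g) (star_cocycle p q g)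
  (@star_map G G K) 1%G (@star_ker_emb G G K) n0 j psi).
- by rewrite irr_count_trivial// mulr1z.
- move=> n y nN _; split; last by case: n {nN}.
  rewrite inE memp memM /= !eqxx andbT /=; move: nN.
  by rewrite memN conjgM.
- by move=> n nN y z /in1 -> /in1 ->.
- move=> [[x1 x2] [x3 x4]]; rewrite inE memp memM /= => /and3P[/eqP-> xc /eqP x23].
  rewrite -x23 in xc *; rewrite memN /= conjgM xc; split=> //.
  by exists 1%g; rewrite ?group1.
- move=> n m nN mN y z _ _; rewrite /j /= !conjMg.
  by [].
- by move=> y /in1 ->; rewrite /j /= conj1g.
- by move=> n y _ _; exact: f0.
- by move=> y _; rewrite /psi.
- by move=> y /in1 ->.
- move=> n m nN mN y z /in1 -> /in1 ->; rewrite alpha1 mulr1 /star_cocycle /conj_nu fE.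
  by rewrite mk_tcocycle /= !conjg_pair /= invgK invg1 !conjg1 !conjgM mulrC.
Qed.

Lemma comp_basis_unit (y : twisted_class k (G * K)%type) :
  comp_basis (class_of (trivial_pair k (diag_group G))) y = basis_elt y.
Proof.
rewrite /comp_basis; set p := class_repr _; set q := class_repr y.
have : twisted_conj (trivial_pair k (diag_group G)) p.
  by apply/class_ofP; rewrite class_reprK.
move=> /twisted_conjP[[s t] /conj_byP[pE [f [f0 f1 fE]]]].
have memD (x : G * G) : (x \in diag_group G) = (x.1 == x.2) by rewrite inE.
(* The diagonal conjugated by (s,t) consists of the (x^s, x^t), that is, of the pairs (u, u^w). *)
pose w := (s^-1 * t)%g.
have memp x : (x \in tgroup p) = (x.2 == x.1 ^ w)%g.
  rewrite pE mem_conjg memD conjg_pair /= /w conjgM.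
  by apply/eqP/eqP => [->|->]; rewrite ?conjgK ?conjgKV.
(* The second projection of the graph is all of [G], which leaves a single double coset. *)
have -> : double_cosets p q = [set [set: G]]%SET.
  have p2 : [set x.2 | x in tgroup p]%SET = [set: G]%SET.
    apply/setP => z; rewrite [RHS]inE; apply/imsetP.
    by exists ((z ^ w^-1)%g, z); rewrite ?memp ?conjgKV.
  rewrite /double_cosets p2; apply/setP => D; rewrite finset.in_set1.
  have TE g : ([set: G] :* g * [set y.1 | y in tgroup q] = [set: G])%g.
    apply/setP => z; rewrite [RHS]inE; apply/mulsgP; exists z 1%g; rewrite ?mulg1//.
      by apply/rcosetP; exists (z * g^-1)%g; rewrite ?inE ?mulgKV.
    by apply/imsetP; exists 1%g; rewrite ?group1.
  by apply/imsetP/eqP => [[g _ ->]|->]; [exact: TE|exists 1%g; rewrite ?TE].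
rewrite big_set1 -[y in RHS]class_reprK -/q.
apply: (@clifford_sum_unit p q w (fun u => f (u ^ s^-1, u ^ s^-1)%g)).
- exact: memp.
- by move=> u; apply: f0; rewrite memD.
- by rewrite conj1g.
- move=> u v; pose x z := (z ^ s^-1, z ^ s^-1)%g.
  have xD z : x z \in diag_group G by rewrite memD.
  have := fE (x u) (x v) (xD u) (xD v).
  rewrite !conjg_pair /= !conjgKV -!conjgM mk_tcocycle mul1r => ->.
  by rewrite conjMg.
Qed.

End Unit.

(** * The action of the ideal J *)

Section PairsOverUnit.

Variables (k : closedFieldType) (G : finGroupType).
Implicit Types (p : twisted_pair k (G * unit)%type) (a : twisted_pair k G).

Local Notation U := (trivial_pair k (1%G : {group unit})).

Lemma mem_unit_group (A : {group unit}) x : x \in A.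
Proof. by case: x; exact: group1. Qed.

Fact left_group_set p : group_set [set x | (x, tt) \in tgroup p]%SET.
Proof.
apply/group_setP; split=> [|x y]; rewrite !inE; first exact: group1.
by move=> xp yp; have := groupM xp yp.
Qed.

Fact left_cocycle p : is_cocycle (Group (left_group_set p))
  (fun x y => tcocycle p (x, tt) (y, tt)).
Proof.
split.
- by move=> x y; rewrite !inE; exact: cocycle_neq0.
- by move=> x; rewrite !inE => xp; split; [exact: cocycle1l xp|exact: cocycle1r xp].
- by move=> x y z; rewrite !inE => xp yp zp; exact: cocycleM xp yp zp.
Qed.

Definition left_pair p : twisted_pair k G := mk_twisted_pair (left_cocycle p).

Fact inv_cocycle a : is_cocycle (tgroup a) (fun x y => (tcocycle a x y)^-1).
Proof.
split.
- by move=> x y xa ya; rewrite invr_neq0 ?cocycle_neq0.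
- by move=> x xa; rewrite cocycle1l// cocycle1r// invr1.
- by move=> x y z xa ya za; rewrite -!invfM cocycleM.
Qed.

(** The factor on [G] of the dual of a pair on G x 1: duality inverts the cocycle. *)
Definition inv_pair a : twisted_pair k G := mk_twisted_pair (inv_cocycle a).

Lemma twisted_conj_inv_inj a a' :
  twisted_conj (inv_pair a) (inv_pair a') -> twisted_conj a a'.
Proof.
move=> /twisted_conjP[t [aE [f f0 fE]]]; apply/twisted_conjP; exists t; split=> //.
exists (fun x => (f x)^-1) => [x xa|x y xa ya]; first by rewrite invr_neq0 ?f0.
have := fE x y xa ya; rewrite !mk_tcocycle => /(congr1 GRing.inv).
by rewrite /= invrK => ->; rewrite !invfM !invrK.
Qed.

Lemma twisted_conj_left p : twisted_conj (prod_pair (left_pair p) U) p.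
Proof.
apply/twisted_conjP; exists 1%g; split.
  by rewrite conjsg1; apply/setP => -[x []]; rewrite mem_setX mem_unit_group inE andbT.
exists (fun=> 1) => [x _|[x []] [y []] _ _]; first exact: oner_neq0.
by rewrite invg1 !conjg1 !mk_tcocycle /= divr1 !mulr1.
Qed.

Lemma twisted_conj_dual p :
  twisted_conj (prod_pair U (inv_pair (left_pair p))) (dual_pair p).
Proof.
apply/twisted_conjP; exists 1%g; split.
  by rewrite conjsg1; apply/setP => -[[] x]; rewrite mem_setX mem_unit_group !inE.
exists (fun=> 1) => [x _|[[] x] [[] y] _ _]; first exact: oner_neq0.
by rewrite invg1 !conjg1 !mk_tcocycle /= divr1 !mulr1 mul1r.
Qed.

End PairsOverUnit.

Lemma twisted_class_trivial (k : closedFieldType) (T : finGroupType) :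
  (forall x : T, x = 1%g) -> forall c c' : twisted_class k T, c = c'.
Proof.
move=> T1 c c'; rewrite -[c]class_reprK -[c']class_reprK; apply/class_ofP.
apply/twisted_conjP; exists 1%g; split.
  by rewrite conjsg1; apply/setP => x; rewrite (T1 x) !group1.
exists (fun=> 1) => [x _|x y _ _]; first exact: oner_neq0.
by rewrite (T1 x) (T1 y) conj1g !cocycle1l// divr1 !mulr1.
Qed.

(** If the conjugated diagonal were A x B, it would contain (x^s, 1) along with every (x^s, x^t),
    forcing x = 1. *)
Lemma diag_not_product (k : closedFieldType) (G : finGroupType)
    (a b : twisted_pair k G) : [set: G]%SET <> 1%g ->
  class_of (trivial_pair k (diag_group G)) <> class_of (prod_pair a b).
Proof.
move=> G1 /class_ofP/twisted_conjP[[s t] [/setP E _]]; apply: G1.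
have {}E x y : (x \in tgroup a) && (y \in tgroup b) = (x ^ s^-1 == y ^ t^-1)%g.
  by have := E (x, y); rewrite mem_setX mem_conjg inE.
apply/setP => x; rewrite inE; apply/esym/set1gP.
have := E (x ^ s)%g (x ^ t)%g; rewrite !conjgK eqxx => /andP[xa _].
have := E (x ^ s)%g 1%g; rewrite xa group1 conjgK conj1g.
by move=> /esym/eqP.
Qed.

Lemma ffun_sum_delta (I : finType) (x : {ffun I -> int}) :
  x = \sum_c [ffun z => (z == c)%:R] *~ x c.
Proof.
apply/ffunP => c; rewrite sum_ffunE (bigD1 c)//= ffunMzE ffunE eqxx.
rewrite big1 => [|e ec]; first by rewrite addr0 intz.
by rewrite ffunMzE ffunE eq_sym (negPf ec) mul0rz.
Qed.

Section Bilinearity.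

Variables (k : closedFieldType).

Lemma basis_eltE (T : finGroupType) (c z : twisted_class k T) :
  basis_elt c z = (z == c)%:R.
Proof. by rewrite ffunE. Qed.

Lemma comp_is_zmod_morphisml (G H K : finGroupType) (y : B k H K) :
  zmod_morphism (fun x : B k G H => comp x y).
Proof.
move=> x z; rewrite /comp; move: (@comp_basis k G H K) => F.
rewrite -sumrB; apply: eq_bigr => a _.
rewrite -sumrB; apply: eq_bigr => b _.
by rewrite !ffunE mulrBl mulrzBr.
Qed.

Lemma comp_basis_elt (G H K : finGroupType) a b :
  comp (basis_elt a : B k G H) (basis_elt b : B k H K) = comp_basis a b.
Proof.
rewrite /comp; move: (@comp_basis k G H K) => F.
rewrite (bigD1 a)//= (bigD1 b)//= !basis_eltE !eqxx big1 => [|c cb]; last first.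
  by rewrite !basis_eltE (negPf cb) mulr0.
rewrite addr0 big1 ?addr0// => c ca; rewrite big1// => e _.
by rewrite !basis_eltE (negPf ca) mul0r.
Qed.

Lemma B_sum_basis (G H : finGroupType) (x : B k G H) :
  x = \sum_c (basis_elt c : B k G H) *~ x c.
Proof. exact: (ffun_sum_delta x). Qed.

End Bilinearity.

Section KernelOfRho.

Variables (k : closedFieldType) (G : finGroupType).
Local Notation Om := (Omega k G).
Local Notation U := (trivial_pair k (1%G : {group unit})).

Definition Omega_pair (c : Om) : twisted_pair k G := left_pair (class_repr c).
Definition Omega_dual_pair (c : Om) : twisted_pair k G := inv_pair (Omega_pair c).
Definition E_class (a b : Om) : twisted_class k (G * G)%type :=
  class_of (prod_pair (Omega_pair a) (Omega_dual_pair b)).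

Lemma Omega_pairE (c : Om) : class_of (prod_pair (Omega_pair c) U) = c.
Proof. by rewrite -[RHS]class_reprK; apply/class_ofP; exact: twisted_conj_left. Qed.

Lemma Omega_dual_pairE (c : Om) :
  dual_class c = class_of (prod_pair U (Omega_dual_pair c)).
Proof. by apply/esym/class_ofP; exact: twisted_conj_dual. Qed.

Lemma Omega_pair_inj (a a' : Om) :
  twisted_conj (Omega_pair a) (Omega_pair a') -> a = a'.
Proof.
move=> aa'; rewrite -(Omega_pairE a) -(Omega_pairE a'); apply/class_ofP.
exact: twisted_conj_prod aa' (twisted_conj_refl U).
Qed.

Lemma E_class_inj a b a' b' : E_class a b = E_class a' b' -> a = a' /\ b = b'.
Proof.
move=> /class_ofP/prod_pair_inj[aa' bb']; split; first exact: Omega_pair_inj.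
exact/Omega_pair_inj/twisted_conj_inv_inj.
Qed.

Lemma setT_unit : [set: unit]%SET = 1%g.
Proof. by apply/setP => -[]; rewrite inE set11. Qed.

Lemma E_eltE a b : E_elt a b = basis_elt (E_class a b).
Proof.
rewrite /E_elt Omega_dual_pairE -[X in comp_basis X]Omega_pairE comp_basis_prod.
by rewrite pairing_trivial ?setT_unit// mulr1z.
Qed.

Lemma comp_coefE b c : comp_coef b c = pairing (Omega_dual_pair b) (Omega_pair c).
Proof.
rewrite /comp_coef Omega_dual_pairE -[X in comp_basis _ X]Omega_pairE comp_basis_prod.
rewrite /B11_int ffunMzE basis_eltE.
rewrite (_ : _ == _ = true) ?mulr1n ?intz//.
by apply/eqP/twisted_class_trivial => -[[] []].
Qed.

Lemma comp_basis_E_Omega a b c :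
  comp_basis (E_class a b) c = (basis_elt a : B k G unit) *~ comp_coef b c.
Proof. by rewrite -{1}(Omega_pairE c) comp_basis_prod Omega_pairE comp_coefE. Qed.

Lemma comp_basis_E_E a b c d :
  comp_basis (E_class a b) (E_class c d)
    = (basis_elt (E_class a d) : B k G G) *~ comp_coef b c.
Proof. by rewrite comp_basis_prod comp_coefE. Qed.

Lemma J_of_mxE M (z : twisted_class k (G * G)%type) : J_of_mx M z =
  \sum_(i < #|Om|) \sum_(j < #|Om|)
    (z == E_class (enum_val i) (enum_val j))%:R * M i j.
Proof.
rewrite /J_of_mx sum_ffunE; apply: eq_bigr => i _.
rewrite sum_ffunE; apply: eq_bigr => j _.
by rewrite E_eltE ffunMzE basis_eltE -mulrzr intz.
Qed.

Lemma J_of_mx_E_class M a b :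
  J_of_mx M (E_class a b) = M (enum_rank a) (enum_rank b).
Proof.
rewrite J_of_mxE (bigD1 (enum_rank a))//= [X in X + _](bigD1 (enum_rank b))//=.
rewrite !enum_rankK eqxx mul1r big1 => [|j jb]; last first.
  rewrite (_ : _ == _ = false) ?mul0r//; apply: contraNF jb => /eqP/E_class_inj[_ ->].
  by rewrite enum_valK.
rewrite addr0 big1 ?addr0// => i ia; rewrite big1// => j _.
rewrite (_ : _ == _ = false) ?mul0r//; apply: contraNF ia => /eqP/E_class_inj[-> _].
by rewrite enum_valK.
Qed.

Lemma J_of_mx_unit M : [set: G]%SET <> 1%g ->
  J_of_mx M (class_of (trivial_pair k (diag_group G))) = 0.
Proof.
move=> G1; rewrite J_of_mxE big1// => i _; rewrite big1// => j _.
by rewrite (_ : _ == _ = false) ?mul0r//; apply/eqP/diag_not_product.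
Qed.

Lemma comp_suml (K : finGroupType) (I : Type) (r : seq I) (x : I -> B k G G) (y : B k G K) :
  comp (\sum_(i <- r) x i) y = \sum_(i <- r) comp (x i) y.
Proof.
pose f : {additive B k G G -> B k G K} := HB.pack (fun x : B k G G => comp x y)
  (GRing.isZmodMorphism.Build _ _ _ (comp_is_zmod_morphisml y)).
exact: (raddf_sum f).
Qed.

Lemma compMzl (K : finGroupType) (x : B k G G) n (y : B k G K) :
  comp (x *~ n) y = comp x y *~ n.
Proof.
pose f : {additive B k G G -> B k G K} := HB.pack (fun x : B k G G => comp x y)
  (GRing.isZmodMorphism.Build _ _ _ (comp_is_zmod_morphisml y)).
exact: (raddfMz f).
Qed.

Lemma rho_J_of_mx M (c : Om) : rho (J_of_mx M) (basis_elt c) =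
  \sum_(i < #|Om|) (basis_elt (enum_val i) : B k G unit)
     *~ (M *m comp_mx k G) i (enum_rank c).
Proof.
rewrite /rho /J_of_mx comp_suml; apply: eq_bigr => i _.
rewrite comp_suml mxE mulrz_sumr; apply: eq_bigr => j _.
rewrite compMzl E_eltE comp_basis_elt comp_basis_E_Omega mxE enum_rankK.
by rewrite -mulrzA mulrC.
Qed.

Lemma rho_unit (y : B k G unit) : rho (unit_elt k G) y = y.
Proof.
rewrite [in LHS](B_sum_basis y) raddf_sum [RHS]B_sum_basis; apply: eq_bigr => c _.
rewrite raddfMz; congr (_ *~ _).
by rewrite -[LHS]/(comp (basis_elt _) _) comp_basis_elt comp_basis_unit.
Qed.

Lemma in_ker_rho_basis (x : B k G G) :
  (forall c : Om, rho x (basis_elt c) = 0) -> in_ker_rho x.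
Proof.
move=> x0 y; rewrite (B_sum_basis y) raddf_sum big1// => c _.
by rewrite raddfMz [X in X *~ _]x0 mul0rz.
Qed.

(** Phrased over the integers with [M *m comp_mx k G = d%:M], so as to cover both the adjugate, with
    [d] the determinant, and an integral multiple of the inverse. *)
Lemma unit_minus_J (d : int) M : [set: G]%SET <> 1%g -> d != 0 ->
    M *m comp_mx k G = d%:M ->
  unit_elt k G *~ d - J_of_mx M <> 0 /\ in_ker_rho (unit_elt k G *~ d - J_of_mx M).
Proof.
move=> G1 d0 MC; split.
  (* The coefficient at the diagonal is [d], since no E_{a,b} contributes there. *)
  move=> /ffunP/(_ (class_of (trivial_pair k (diag_group G)))).
  rewrite !ffunE ffunMzE basis_eltE eqxx J_of_mx_unit// oppr0 addr0 intz.
  by move/eqP; rewrite (negPf d0).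
apply: in_ker_rho_basis => c.
have rhoB (x y : B k G G) z : rho (x - y) z = rho x z - rho y z.
  exact: comp_is_zmod_morphisml.
rewrite rhoB rho_J_of_mx MC /rho compMzl -/(rho _ _) rho_unit.
rewrite (bigD1 (enum_rank c))//= big1 => [|i ic].
  by rewrite addr0 enum_rankK mxE eqxx mulr1n subrr.
by rewrite mxE (negPf ic) mulr0z.
Qed.

Lemma singular_ker : \det (comp_mx k G) = 0 ->
  exists x : B k G G, [/\ in_ker_rho x, in_J x & x <> 0].
Proof.
(* [det0P] works over the integers, so [v] is integral. Every row of [M] is [v]; a nonzero entry of
   [v] in column [j] shows up as the coefficient of the diagonal unit at [j]. *)
move=> /eqP/det0P[v v0 vC]; pose M : 'M_#|Om| := const_mx 1 *m v.
exists (J_of_mx M); split; last 2 first.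
- by exists M.
- move=> M0; case/rV0Pn: v0 => j /eqP; apply.
  have /ffunP/(_ (E_class (enum_val j) (enum_val j))) := M0.
  by rewrite J_of_mx_E_class enum_valK ffunE mxE big_ord1 mxE mul1r.
- apply: in_ker_rho_basis => c; rewrite rho_J_of_mx big1// => i _.
  by rewrite /M -mulmxA vC mulmx0 mxE mulr0z.
Qed.

Lemma rho_injective_trivial : injective (@rho k G) <-> [set: G]%SET = 1%g.
Proof.
split=> [inj|G1].
  have ker0 (x : B k G G) : in_ker_rho x -> x = 0.
    move=> xk; apply: inj; apply/funext => y; rewrite xk.
    by rewrite /rho -(mulr0z x) compMzl mulr0z.
  have [//|/eqP G1] := eqVneq [set: G]%SET 1%g.
  have [/singular_ker[x [/ker0]]//|detC] := eqVneq (\det (comp_mx k G)) 0.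
  (* The adjugate times the matrix is the determinant, an integral solution with d = det C. *)
  have [] := unit_minus_J G1 detC (mul_adj_mx _).
  by move=> + /ker0.
have all1 (x : G) : x = 1%g by apply/set1gP; rewrite -G1 inE.
(* For trivial [G] the ring has rank one, so an element is an integer multiple of the unit and its
   action on a basis element reveals the integer. *)
move=> x y; have all_eq (z z' : twisted_class k (G * G)%type) : z = z'.
  by apply: twisted_class_trivial => -[u v]; rewrite (all1 u) (all1 v).
have xE (z : B k G G) : z = unit_elt k G *~ z (class_of (trivial_pair k (diag_group G))).
  apply/ffunP => c; rewrite ffunMzE basis_eltE.
  by rewrite (all_eq c (class_of (trivial_pair k (diag_group G)))) eqxx intz.
rewrite (xE x) (xE y); move: (x _) (y _) => n m nm; congr (_ *~ _).
pose c : Om := class_of (trivial_pair k [set: G * unit]%G).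
have := congr1 (fun f => (f (basis_elt c) : B k G unit) c) nm.
rewrite /rho !compMzl -/(rho _ _) rho_unit !ffunMzE basis_eltE eqxx !intz.
exact.
Qed.

End KernelOfRho.

(** * Rational coefficients: the span of the E_{a,b} and its image in End *)

Section MatrixUnits.

Variables (n : nat) (Z : finType) (e : 'I_n -> 'I_n -> Z).
Hypothesis e_inj : forall i j i' j', e i j = e i' j' -> i = i' /\ j = j'.

Definition unit_vector i j : {ffun Z -> rat^o} := [ffun z => (z == e i j)%:R].

Definition unit_sum (m : 'M[rat]_n) : {ffun Z -> rat^o} :=
  \sum_i \sum_j m i j *: unit_vector i j.

Lemma scale_unit_vector (a : rat) i j z :
  (a *: unit_vector i j) z = a * (z == e i j)%:R.
Proof. by rewrite !ffunE. Qed.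

Lemma unit_sumE m i j : unit_sum m (e i j) = m i j.
Proof.
rewrite /unit_sum sum_ffunE (bigD1 i)//= sum_ffunE (bigD1 j)//=.
rewrite scale_unit_vector eqxx mulr1 big1 => [|j' jj']; last first.
  rewrite scale_unit_vector (_ : _ == _ = false) ?mulr0//.
  by apply: contraNF jj' => /eqP/e_inj[_ ->].
rewrite addr0 big1 ?addr0// => i' ii'; rewrite sum_ffunE big1// => j' _.
rewrite scale_unit_vector (_ : _ == _ = false) ?mulr0//.
by apply: contraNF ii' => /eqP/e_inj[->].
Qed.

Lemma unit_sum_inj : injective unit_sum.
Proof. by move=> m m' mm'; apply/matrixP => i j; rewrite -!unit_sumE mm'. Qed.

Lemma sum_unit_sum (W : lmodType rat) m (F : Z -> W) :
  \sum_z (unit_sum m z : rat) *: F z = \sum_i \sum_j m i j *: F (e i j).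
Proof.
under eq_bigr do rewrite sum_ffunE scaler_suml.
rewrite exchange_big; apply: eq_bigr => i _ /=.
under eq_bigr do rewrite sum_ffunE scaler_suml.
rewrite exchange_big; apply: eq_bigr => j _ /=.
rewrite (bigD1 (e i j))//= big1 => [|z zE].
  by rewrite scale_unit_vector eqxx addr0 mulr1.
by rewrite scale_unit_vector (negPf zE) mulr0 scale0r.
Qed.

(** The product of a Munn algebra: the sandwich matrix [c] sits between the coefficient matrices.
    This is why right multiplication by C turns it into the ordinary matrix product. *)
Lemma unit_sum_mul m (c : 'M[rat]_n) m' (op : Z -> Z -> {ffun Z -> rat^o}) :
    (forall i j i' j', op (e i j) (e i' j') = (c j i' : rat) *: unit_vector i j') ->
  \sum_z \sum_z' ((unit_sum m z : rat) * (unit_sum m' z' : rat)) *: op z z'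
    = unit_sum (m *m c *m m').
Proof.
move=> opE.
transitivity (\sum_z (unit_sum m z : rat) *:
    (\sum_i' \sum_j' m' i' j' *: op z (e i' j'))).
  apply: eq_bigr => z _; rewrite -sum_unit_sum scaler_sumr.
  by apply: eq_bigr => z' _; rewrite scalerA.
rewrite sum_unit_sum /unit_sum; apply: eq_bigr => i _.
transitivity (\sum_j \sum_i' \sum_j' (m i j * c j i' * m' i' j') *: unit_vector i j').
  apply: eq_bigr => j _; rewrite scaler_sumr; apply: eq_bigr => i' _.
  rewrite scaler_sumr; apply: eq_bigr => j' _.
  by rewrite opE !scalerA; congr (_ *: _); rewrite mulrAC mulrA.
under eq_bigr do rewrite exchange_big.
rewrite exchange_big; apply: eq_bigr => j' _ /=.
rewrite mxE scaler_suml exchange_big; apply: eq_bigr => i' _ /=.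
by rewrite mxE mulr_suml scaler_suml.
Qed.

End MatrixUnits.

Section MatrixEndomorphism.

Variable I : finType.
Local Notation V := {ffun I -> rat^o}.

(** The function underlying [End_of_mx], over any finite index type; [QJ_to_EndE] identifies the two
    by computation. *)
Definition mx_act (M : 'M[rat]_#|I|) (y : V) : V :=
  [ffun a => \sum_(b : I) M (enum_rank a) (enum_rank b) * (y b : rat)].

Lemma mx_act_linear M : linear (mx_act M).
Proof.
move=> c u v; apply/ffunP => x; rewrite !ffunE.
rewrite [X in _ = X + _]mulr_sumr -big_split; apply: eq_bigr => b _ /=.
by rewrite !ffunE mulrDr; congr (_ + _); rewrite mulrCA.
Qed.

Lemma linfun_mx_act M y : linfun (mx_act M) y = mx_act M y.
Proof.
pose fL : {linear V -> V} :=
  HB.pack (mx_act M) (GRing.isLinear.Build _ _ _ _ _ (mx_act_linear M)).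
exact: (lfunE fL y).
Qed.

Lemma mx_act_delta M b :
  mx_act M [ffun z => (z == b)%:R] = [ffun a => M (enum_rank a) (enum_rank b)].
Proof.
apply/ffunP => a; rewrite !ffunE (bigD1 b)//= ffunE eqxx mulr1 big1 ?addr0// => c cb.
by rewrite ffunE (negPf cb) mulr0.
Qed.

Lemma linfun_mx_act_inj : injective (fun M => linfun (mx_act M)).
Proof.
move=> M M' /lfunP MM'; apply/matrixP => i j.
have := MM' [ffun z => (z == enum_val j)%:R].
rewrite !linfun_mx_act !mx_act_delta => /ffunP/(_ (enum_val i)).
by rewrite !ffunE !enum_valK.
Qed.

Lemma linfun_mx_act_surj (u : 'End(V)) : exists M, linfun (mx_act M) = u.
Proof.
pose d b : V := [ffun z => (z == b)%:R].
exists (\matrix_(i, j) (u (d (enum_val j)) (enum_val i) : rat)).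
apply/lfunP => y; rewrite linfun_mx_act.
have -> : y = \sum_b (y b : rat) *: d b.
  apply/ffunP => b; rewrite sum_ffunE (bigD1 b)//= big1 => [|c cb].
    by rewrite !ffunE eqxx addr0 [RHS]mulr1.
  by rewrite !ffunE eq_sym (negPf cb) [LHS]mulr0.
rewrite linear_sum.
pose fL M : {linear V -> V} :=
  HB.pack (mx_act M) (GRing.isLinear.Build _ _ _ _ _ (mx_act_linear M)).
rewrite -[mx_act _]/(fL _ : V -> V) linear_sum; apply: eq_bigr => b _.
rewrite !linearZ /=; congr (_ *: _); rewrite mx_act_delta.
by apply/ffunP => a; rewrite ffunE mxE !enum_rankK.
Qed.

Lemma linfun_mx_actM M M' :
  linfun (mx_act (M *m M')) = (linfun (mx_act M) \o linfun (mx_act M'))%VF.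
Proof.
apply/lfunP => y; rewrite comp_lfunE !linfun_mx_act; apply/ffunP => a; rewrite !ffunE.
under eq_bigr => b _.
  rewrite mxE mulr_suml; over.
rewrite exchange_big [RHS](reindex (@enum_val _ I)) /=; last first.
  by exists enum_rank => i _; rewrite ?enum_valK ?enum_rankK.
apply: eq_bigr => j _; rewrite enum_valK ffunE mulr_sumr; apply: eq_bigr => b _.
by rewrite enum_valK mulrA.
Qed.

Lemma linfun_mx_act_linear : linear (fun M => linfun (mx_act M)).
Proof.
move=> c M M'; apply/lfunP => y; rewrite add_lfunE scale_lfunE !linfun_mx_act.
apply/ffunP => a; rewrite !ffunE [X in _ = X + _]mulr_sumr -big_split; apply: eq_bigr => b _ /=.
by rewrite !mxE mulrDl mulrA.
Qed.

End MatrixEndomorphism.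

Section RationalSpan.

Variables (k : closedFieldType) (G : finGroupType).
Local Notation Om := (Omega k G).

Let e (i j : 'I_#|Om|) : twisted_class k (G * G)%type :=
  E_class (enum_val i) (enum_val j).

Let e_inj i j i' j' : e i j = e i' j' -> i = i' /\ j = j'.
Proof. by move=> /E_class_inj[/enum_val_inj -> /enum_val_inj ->]. Qed.

Lemma to_QR_basis (c : twisted_class k (G * G)%type) :
  to_QR (basis_elt c) = [ffun z => (z == c)%:R].
Proof. by apply/ffunP => z; rewrite !ffunE natz -pmulrn. Qed.

Lemma to_QRM (x : B k G G) n : to_QR (x *~ n) = (n%:~R : rat) *: to_QR x.
Proof. by apply/ffunP => z; rewrite ffunE ffunMzE ffunE ffunE mulrzz rmorphM mulrC. Qed.

Lemma to_QR_E i j : to_QR (E_elt (enum_val i) (enum_val j)) = unit_vector e i j.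
Proof. by rewrite E_eltE to_QR_basis. Qed.

Definition QJ_of_mx (m : 'M[rat]_#|Om|) : QR k G := unit_sum e m.

Lemma QJ_of_mx_in m : QJ_of_mx m \in QJ k G.
Proof.
apply: memv_suml => i _; apply: memv_suml => j _; apply/memvZ/memv_span.
have := mem_tnth (enum_rank (enum_val i : Om, enum_val j : Om)) (QE_tuple k G).
by rewrite tnth_mktuple enum_rankK to_QR_E.
Qed.

Lemma nth_QE_tuple (l : 'I_#|{: Om * Om}|) :
  (QE_tuple k G)`_l = to_QR (E_elt (enum_val l).1 (enum_val l).2).
Proof. by rewrite -tnth_nth tnth_mktuple. Qed.

Lemma QJ_mxK X : X \in QJ k G -> QJ_of_mx (QJ_mx X) = X.
Proof.
move=> XJ; rewrite [RHS](coord_span XJ).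
rewrite (reindex (fun p : 'I_#|Om| * 'I_#|Om| =>
  enum_rank (enum_val p.1 : Om, enum_val p.2 : Om))); last first.
  exists (fun l => (enum_rank (enum_val l).1, enum_rank (enum_val l).2)) => [[i j]|l] _.
    by rewrite enum_rankK !enum_valK.
  by rewrite !enum_rankK -surjective_pairing enum_valK.
rewrite /QJ_of_mx /unit_sum pair_bigA; apply: eq_bigr => -[i j] _.
by rewrite nth_QE_tuple enum_rankK mxE to_QR_E.
Qed.

(** Linear independence of the E_{a,b} enters here, through [unit_sum_inj]: by [QJ_mxK] both
    matrices have the same image. *)
Lemma QJ_of_mxK m : QJ_mx (QJ_of_mx m) = m.
Proof. by apply: (unit_sum_inj e_inj); exact/QJ_mxK/QJ_of_mx_in. Qed.

Lemma QR_mul_QJ_of_mx m m' : QR_mul (QJ_of_mx m) (QJ_of_mx m')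
  = QJ_of_mx (m *m map_mx intr (comp_mx k G) *m m').
Proof.
apply: unit_sum_mul => i j i' j'.
by rewrite comp_basis_E_E to_QRM to_QR_basis !mxE.
Qed.

Lemma QJ_mx_linear : linear (@QJ_mx k G).
Proof. by move=> c X Y; apply/matrixP => i j; rewrite !mxE linearP. Qed.

Lemma QJ_to_EndE X :
  QJ_to_End X = linfun (@mx_act Om (QJ_mx X *m map_mx intr (comp_mx k G))).
Proof. by []. Qed.

Lemma QJ_to_End_linear : linear (@QJ_to_End k G).
Proof.
move=> c X Y; rewrite !QJ_to_EndE QJ_mx_linear mulmxDl -scalemxAl.
exact: linfun_mx_act_linear.
Qed.

Lemma QJ_to_End_mul : {in QJ k G &, forall X Y,
  QR_mul X Y \in QJ k G /\ QJ_to_End (QR_mul X Y) = (QJ_to_End X \o QJ_to_End Y)%VF}.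
Proof.
move=> X Y XJ YJ; rewrite -{1 2}(QJ_mxK XJ) -{1 2}(QJ_mxK YJ) QR_mul_QJ_of_mx.
split; first exact: QJ_of_mx_in.
by rewrite !QJ_to_EndE QJ_of_mxK -mulmxA; exact: linfun_mx_actM.
Qed.

Hypothesis detC : \det (comp_mx k G) <> 0.

Lemma comp_mx_unit : map_mx intr (comp_mx k G) \in @unitmx rat #|Om|.
Proof. by rewrite unitmxE det_map_mx unitfE intr_eq0; exact/eqP. Qed.

Lemma QJ_to_End_inj : {in QJ k G &, injective (@QJ_to_End k G)}.
Proof.
move=> X Y XJ YJ; rewrite !QJ_to_EndE => /linfun_mx_act_inj /(can_inj (mulmxK comp_mx_unit)) XY.
by rewrite -(QJ_mxK XJ) XY QJ_mxK.
Qed.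

Lemma QJ_to_End_surj (u : 'End(QOmega k G)) :
  exists2 X, X \in QJ k G & QJ_to_End X = u.
Proof.
have [M Mu] := @linfun_mx_act_surj Om u.
exists (QJ_of_mx (M *m invmx (map_mx intr (comp_mx k G)))); first exact: QJ_of_mx_in.
by rewrite QJ_to_EndE QJ_of_mxK mulmxKV ?comp_mx_unit.
Qed.

End RationalSpan.

Theorem proposition3p6 (k : closedFieldType) (hk : [pchar k] =i pred0)
    (G : finGroupType) :
  (injective (@rho k G) <-> [set: G]%SET = 1%g) /\
  ([set: G]%SET <> 1%g ->
   [/\ \det (comp_mx k G) = 0 ->
         exists x : B k G G, [/\ in_ker_rho x, in_J x & x <> 0],
       \det (comp_mx k G) <> 0 ->
         [/\ linear (@QJ_to_End k G),
             {in QJ k G &, injective (@QJ_to_End k G)},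
             forall u : 'End(QOmega k G),
               exists2 X, X \in QJ k G & QJ_to_End X = u
           & {in QJ k G &, forall X Y,
               QR_mul X Y \in QJ k G /\
               QJ_to_End (QR_mul X Y) = (QJ_to_End X \o QJ_to_End Y)%VF}]
     & \det (comp_mx k G) <> 0 ->
         forall (d : nat) (M : 'M[int]_#|Omega k G|), (0 < d)%N ->
           map_mx intr M
             = d%:R *: invmx (map_mx intr (comp_mx k G)) :> 'M[rat]_#|Omega k G| ->
           unit_elt k G *+ d - J_of_mx M <> 0 /\
           in_ker_rho (unit_elt k G *+ d - J_of_mx M)]).
Proof.
split; first exact: rho_injective_trivial.
move=> G1; split; first exact: singular_ker.
- move=> detC; split.
  + exact: QJ_to_End_linear.
  + exact: QJ_to_End_inj.
  + exact: QJ_to_End_surj.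
  + exact: QJ_to_End_mul.
- move=> detC d M d0 ME; rewrite pmulrn; apply: unit_minus_J => //.
    by rewrite eqz_nat -lt0n.
  (* The identity M C = d holds over the rationals by the choice of [M], and descends because the
     integers embed. *)
  have MC : map_mx intr (M *m comp_mx k G) = (d%:R)%:M :> 'M[rat]_#|Omega k G|.
    by rewrite map_mxM ME -scalemxAl mulVmx ?comp_mx_unit// scalemx1.
  apply/matrixP => i j; apply: (@intr_inj rat).
  have /matrixP/(_ i j) := MC; rewrite mxE => ->.
  by rewrite !mxE rmorphMn.
Qed.
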